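(* Let $\Gamma$ be a splice diagram with $n$ leaves satisfying the edge determinant and semigroup conditions and let $\mathcal{S}(\Gamma)$ be a splice type system for $\Gamma$. Then for every star-full subtree $T$ of $\Gamma$ we have $\Delta_T\cap\mathrm{Trop}^{+}\mathcal{S}(\Gamma)\subseteq\rho(T)$, where $\Delta_T=\mathrm{conv}\{\rho(u):u\text{ a leaf of }T\}$.
   Context: A splice diagram is a finite tree $\Gamma$ with at least one vertex of valency $\geq3$ and no vertex of valency $2$; vertices of valency $1$ are leaves, others nodes; $\delta_v$ is the valency of $v$. For each node $v$ and edge $e$ at $v$ a positive integer weight $d_{v,e}$ is given; $d_v=\prod_{e\ni v}d_{v,e}$; $d_{v,u}$ is the weight at $v$ of the edge toward $u$. For distinct vertices $u,v$, $\ell_{u,v}$ is the product of all $d_{w,e}$ with $w$ a node on the geodesic $[u,v]$ and $e$ an edge at $w$ not in $[u,v]$; $\ell_{v,v}=d_v$. Edge determinant condition: $d_{u,v}d_{v,u}>\ell_{u,v}$ for every edge between nodes. Semigroup condition: for each node $v$ and edge $e$ at $v$, $d_v\in\sum_{\lambda\in L(v,e)}\mathbb{N}\ell_{v,\lambda}$, $L(v,e)$ the leaves $\lambda$ with $e\subseteq[v,\lambda]$. Variables $z_\lambda$ and standard basis vectors $w_\lambda$ of $\mathbb{R}^n$ are indexed by leaves; $w_u=\sum_\lambda\ell_{u,\lambda}w_\lambda$ for nodes $u$. Fix $\alpha_{v,e,\lambda}\in\mathbb{N}$ with $d_v=\sum_{\lambda\in L(v,e)}\alpha_{v,e,\lambda}\ell_{v,\lambda}$,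 $z^{m_{v,e}}=\prod z_\lambda^{\alpha_{v,e,\lambda}}$, $m_{v,e}=\sum\alpha_{v,e,\lambda}w_\lambda$. A splice type system is a family $F_{v,i}=f_{v,i}+g_{v,i}\in\mathcal{O}:=\mathbb{C}\{z_\lambda\}$ ($v$ node, $1\le i\le\delta_v-2$), $f_{v,i}=\sum_{e\ni v}c_{v,e,i}z^{m_{v,e}}$ with all maximal minors of $(c_{v,e,i})_{e,i}$ nonzero, $g_{v,i}$ convergent with every exponent $m$ satisfying $w_v\cdot m>d_v$ and $w_u\cdot m>\ell_{u,v}$ for nodes $u\ne v$. For $w\in\mathbb{R}^n_{\ge0}$, $\mathrm{in}_w(f)$ is the sum of terms of minimal $w$-weight and $\mathrm{in}_w(I)$ the ideal of $\mathcal{O}$ generated by all $\mathrm{in}_w(f)$, $f\in I$. $\mathrm{Trop}^+\mathcal{S}(\Gamma)$ is the set of $w\in\mathbb{R}_{>0}^n$ such that $\mathrm{in}_w(I)$ contains no monomial, $I$ the ideal generated by $\mathcal{S}(\Gamma)$. $\rho:\Gamma\to\mathbb{R}^n$ sends each vertex $u$ to $w_u/|w_u|$ ($1$-norm), affinely on edges. A subtree $T$ is a connected subgraph of $\Gamma$; its leaves are its vertices of valency $\le1$ in $T$, its nodes the others; $T$ is star-full if all edges of $\Gamma$ adjacent to each node of $T$ belong to $T$. *)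

(* Defs.v *)
From HB Require Import structures.
From mathcomp Require Import all_boot all_order all_algebra.
From mathcomp Require Import boolp classical_sets reals.
From mathcomp Require Import complex.

Set Implicit Arguments.
Unset Strict Implicit.
Unset Printing Implicit Defensive.

Import Order.TTheory GRing.Theory Num.Theory.
Local Open Scope ring_scope.

Section Graph.
Variables (V : finType) (e : rel V).

Definition valency (v : V) : nat := #|[set u | e v u]|.
Definition is_leaf (v : V) : bool := valency v == 1%N.
Definition is_node (v : V) : bool := valency v != 1%N.

Definition is_tree : Prop :=
  [/\ symmetric e, irreflexive e,
      (forall x y : V, connect e x y) &
      (forall (x : V) (p : seq V), path e x p -> uniq (x :: p) ->
          (2 <= size p)%N -> ~~ e (last x p) x)].

Definition is_splice_tree : Prop :=
  [/\ is_tree, (exists v, 3 <= valency v)%N & forall v, valency v != 2%N].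

Definition on_geod (u v w : V) : bool :=
  `[< exists p : seq V, [/\ path e u p, last u p = v, uniq (u :: p)
                          & w \in u :: p] >].

End Graph.

(* type of leaves; coordinates of R^n are indexed by the leaves *)
Definition leafT (V : finType) (e : rel V) := {v : V | is_leaf e v}.

Section Splice.
Variables (V : finType) (e : rel V) (d : V -> V -> nat).
(* d v u = weight d_{v,e} at the node v of the edge e = {v,u} *)

Definition dv (v : V) : nat := (\prod_(u | e v u) d v u)%N.

(* ell u v : product of d_{w,x} over nodes w of [u,v] and edges {w,x}
   at w not in [u,v] (in a tree, {w,x} is in [u,v] iff x is on [u,v]). *)
Definition ell (u v : V) : nat :=
  (\prod_(w | is_node e w && on_geod e u v w)
     \prod_(x | e w x && ~~ on_geod e u v x) d w x)%N.

Definition edge_determinant : Prop :=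
  forall u v, is_node e u -> is_node e v -> e u v ->
    (ell u v < d u v * d v u)%N.

(* L(v,{v,x}) : leaves lambda with the edge {v,x} contained in [v,lambda] *)
Definition inL (v x : V) (l : leafT e) : bool := on_geod e v (val l) x.

Definition admissible (v x : V) (alpha : leafT e -> nat) : Prop :=
  (forall l, alpha l != 0%N -> inL v x l) /\
  dv v = (\sum_(l : leafT e) alpha l * ell v (val l))%N.

Definition semigroup_condition : Prop :=
  forall v x, is_node e v -> e v x -> exists alpha, admissible v x alpha.

Definition positive_weights : Prop :=
  forall v x, is_node e v -> e v x -> (0 < d v x)%N.

Definition splice_diagram : Prop :=
  is_splice_tree e /\ positive_weights.

Variable R : realType.

Definition wvec (u : V) : leafT e -> R :=
  fun l => if is_leaf e u then (val l == u)%:R else (ell u (val l))%:R.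

Definition norm1 (p : leafT e -> R) : R := \sum_(l : leafT e) `|p l|.

Definition rho (u : V) : leafT e -> R := fun l => wvec u l / norm1 (wvec u).

Definition subrel (T : {set V}) : rel V := [rel x y | [&& e x y, x \in T & y \in T]].

(* a subtree is a (nonempty) connected subgraph; in a tree a connected
   subgraph is the induced subgraph on its vertex set *)
Definition subtree (T : {set V}) : Prop :=
  T != finset.set0 /\ forall x y, x \in T -> y \in T -> connect (subrel T) x y.

Definition leaf_of (T : {set V}) (u : V) : bool :=
  (u \in T) && (#|[set x | subrel T u x]| <= 1)%N.
Definition node_of (T : {set V}) (u : V) : bool :=
  (u \in T) && ~~ (#|[set x | subrel T u x]| <= 1)%N.

Definition star_full (T : {set V}) : Prop :=
  forall u, node_of T u -> forall x, e u x -> x \in T.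

Definition rhoT (T : {set V}) : set (leafT e -> R) :=
  fun p => (exists2 u, u \in T & p = rho u) \/
           (exists u x t, [/\ subrel T u x, 0 <= t, t <= 1 &
               p = (fun l => (1 - t) * rho u l + t * rho x l)]).

Definition DeltaT (T : {set V}) : set (leafT e -> R) :=
  fun p => exists c : V -> R,
    [/\ forall u, 0 <= c u, forall u, ~~ leaf_of T u -> c u = 0,
        \sum_u c u = 1 &
        p = (fun l => \sum_u c u * rho u l)].

End Splice.

Section PowerSeries.
Variables (L : finType) (C : numDomainType).

Definition mexp := {ffun L -> nat}.
Definition pser := mexp -> C.

Definition msize (m : mexp) : nat := (\sum_l m l)%N.

(* convergent in some polydisc around 0 (Cauchy estimate form) *)
Definition convergent (f : pser) : Prop :=
  exists r M : C, 0 < r /\ forall m, `|f m| * r ^+ msize m <= M.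

Definition monom (m0 : mexp) : pser := fun m => (m == m0)%:R.

Definition pmul (f g : pser) : pser := fun m =>
  \sum_(a : {dffun forall l : L, 'I_(m l).+1})
      f [ffun l => val (a l)] * g [ffun l => (m l - val (a l))%N].

Definition ideal_gen (S : set pser) : set pser := fun f =>
  exists (K : nat) (h g : 'I_K -> pser),
    [/\ forall k, convergent (h k), forall k, S (g k) &
        forall m, f m = \sum_(k < K) pmul (h k) (g k) m].

Variable R : realType.
Definition wdot (w : L -> R) (m : mexp) : R := \sum_l w l * (m l)%:R.

Definition in_w (w : L -> R) (f : pser) : pser := fun m =>
  if `[< forall m', f m' != 0 -> wdot w m <= wdot w m' >] then f m else 0.

Definition in_ideal (w : L -> R) (I : set pser) : set pser :=
  ideal_gen (fun g => exists2 f, I f & g = in_w w f).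

Definition tropP (I : set pser) : set (L -> R) := fun w =>
  (forall l, 0 < w l) /\ ~ (exists m, in_ideal w I (monom m)).

End PowerSeries.

Section SpliceSystem.
Variables (V : finType) (e : rel V) (d : V -> V -> nat) (R : realType).
Local Notation C := (R[i]).
Local Notation L := (leafT e).

(* alpha v x : the fixed exponent alpha_{v,{v,x},.};  c v x i = c_{v,{v,x},i};
   g v i = g_{v,i}; indices i range over 0 <= i < delta_v - 2. *)
Definition mvx (alpha : V -> V -> L -> nat) (v x : V) : mexp L :=
  [ffun l => alpha v x l].

Definition Fsys (alpha : V -> V -> L -> nat) (c : V -> V -> nat -> C)
    (g : V -> nat -> pser L C) (v : V) (i : nat) : pser L C :=
  fun m => \sum_(x | e v x) (if m == mvx alpha v x then c v x i else 0)
           + g v i m.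

(* node weight w_u . m (integer valued) *)
Definition nweight (u : V) (m : mexp L) : nat :=
  (\sum_(l : L) ell e d u (val l) * m l)%N.

Definition splice_type_system (alpha : V -> V -> L -> nat)
    (c : V -> V -> nat -> C) (g : V -> nat -> pser L C) : Prop :=
  [/\ (forall v x, is_node e v -> e v x -> @admissible V e d v x (alpha v x)),
      (forall v, is_node e v ->
         forall sigma : 'I_(valency e v - 2) -> V, injective sigma ->
           (forall j, e v (sigma j)) ->
           \det (\matrix_(a, b) c v (sigma a) (val b)) != 0),
      (forall v i, is_node e v -> (i < valency e v - 2)%N -> convergent (g v i)) &
      (forall v i, is_node e v -> (i < valency e v - 2)%N ->
         forall m, g v i m != 0 ->
           (dv e d v < nweight v m)%N /\
           forall u, is_node e u -> u != v -> (ell e d u v < nweight u m)%N)].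

Definition system_ideal (alpha : V -> V -> L -> nat)
    (c : V -> V -> nat -> C) (g : V -> nat -> pser L C) : set (pser L C) :=
  ideal_gen (fun F => exists v i, [/\ is_node e v, (i < valency e v - 2)%N &
                                       F = Fsys alpha c g v i]).

End SpliceSystem.

(* Main.v *)
(** Write a point [p] of [Delta_T] as a nonnegative combination of the [w_u], [u] in [T],
    and let [S] be its support.  At a node [v] the weights [p . m_{v,x}] have a minimum
    that is computed edge by edge; say that the branch at [x] has excess if it exceeds
    this minimum, which by the edge determinant condition happens as soon as the branch
    contains a node of [S].  If at least two, but not all, branches at [v] have excess,
    the condition on the minors gives a linear combination of the [F_{v,i}] whose
    [p]-initial form is a monomial.  For tropical [p], two branches with excess thus force
    excess on all of them, and this propagates through the tree: unless [S] is contained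
    in an edge, some [w_v], with [v] a node of [T], is a nonnegative combination of the
    [w_u] with [u] in [S] and [u <> v].  That is impossible for a decomposition that
    minimises a strictly convex potential, so [S] is contained in an edge of [T]. *)
Require Import Defs.
From HB Require Import structures.
From mathcomp Require Import all_boot all_order all_algebra.
From mathcomp Require Import boolp classical_sets reals.
From mathcomp Require Import complex.
From mathcomp Require topology normedtype derive.
From mathcomp Require Import zify ring lra.
Import Order.TTheory GRing.Theory Num.Theory.
Set Implicit Arguments.
Unset Strict Implicit.
Unset Printing Implicit Defensive.
Local Open Scope ring_scope.

(** * Geodesics in trees *)

Section Tree.
Local Open Scope nat_scope.
Variables (V : finType) (e : rel V).
Hypothesis tree_e : is_tree e.

Lemma tree_sym : symmetric e. Proof. by case: tree_e. Qed.
Lemma tree_irr : irreflexive e. Proof. by case: tree_e. Qed.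

Definition del_edge (x z : V) : rel V :=
  fun a b => e a b && ~~ ((a == x) && (b == z) || (a == z) && (b == x)).

Lemma del_edge_sym x z : symmetric (del_edge x z).
Proof.
move=> a b; rewrite /del_edge /= tree_sym; congr (_ && ~~ _).
by rewrite orbC andbC [X in _ || X]andbC.
Qed.

(** A simple path from [x] to [z] avoiding the edge has at least two steps, so the edge would close
    it to a cycle. *)
Lemma tree_bridge x z : e x z -> ~~ connect (del_edge x z) x z.
Proof.
move=> exz; apply/negP => /connectP[p].
case/shortenP => q pq uq _ zE.
have sub : subrel (del_edge x z) e by move=> a b /andP[].
case: tree_e => _ _ _ /(_ x q (sub_path sub pq) uq).
rewrite -zE tree_sym exz => /(_ _)/notF; apply.
case: q pq uq zE => [|y [|y' q]] //=.
- by move=> _ _ zx; rewrite zx tree_irr in exz.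
- by rewrite andbT => /andP[_]; move=> + _ zy; rewrite -zy !eqxx.
Qed.

Lemma path_avoid x z y p : path e y p -> x \notin y :: p -> path (del_edge x z) y p.
Proof.
elim: p y => //= a p IH y /andP[eya pa].
rewrite !inE !negb_or => /and3P[xy xa xp].
rewrite IH // ?inE ?negb_or ?xa // andbT /del_edge eya /=.
by rewrite ![_ == x]eq_sym (negbTE xy) (negbTE xa) andbF.
Qed.

(** If the first steps differ, both [x] and [z] reach the common end without the edge between them,
    against [tree_bridge]. *)
Lemma simple_path_unique x p q : path e x p -> path e x q ->
  uniq (x :: p) -> uniq (x :: q) -> last x p = last x q -> p = q.
Proof.
elim: p x q => [|z p IH] x [|z' q] //.
- by move=> _ _ _ /andP[/negP xq _] /= xE; case: xq; rewrite xE mem_last.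
- by move=> _ _ /andP[/negP xq _] _ /= xE; case: xq; rewrite -xE mem_last.
move=> /= /andP[exz pp] /andP[exz' pq] /andP[xp up] /andP[xq uq] lE.
have [zz'|zz'] := eqVneq z z'.
  by rewrite -zz' in pq uq lE *; rewrite (IH z q).
case/negP: (tree_bridge exz).
have c1 : connect (del_edge x z) z (last z p).
  by apply/connectP; exists p => //; exact: path_avoid.
have c2 : connect (del_edge x z) x (last z p).
  apply/connectP; exists (z' :: q) => //=; rewrite path_avoid // andbT.
  rewrite /del_edge exz' eqxx eq_sym (negbTE zz') /=.
  by apply/negP => /andP[/eqP xz _]; rewrite -xz tree_irr in exz.
by rewrite (connect_trans c2) // (sym_connect_sym (del_edge_sym x z)).
Qed.

Lemma simple_pathE x y : exists p, [/\ path e x p, last x p = y & uniq (x :: p)].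
Proof.
case: tree_e => _ _ /(_ x y)/connectP[p] + -> _.
by case/shortenP => q pq uq _; exists q.
Qed.

Definition gpath x y : seq V := sval (cid (simple_pathE x y)).

Lemma gpathP x y : [/\ path e x (gpath x y), last x (gpath x y) = y & uniq (x :: gpath x y)].
Proof. by rewrite /gpath; case: cid. Qed.

Lemma gpath_unique x p : path e x p -> uniq (x :: p) -> gpath x (last x p) = p.
Proof.
move=> pp up; have [pg lg ug] := gpathP x (last x p).
exact: simple_path_unique pg pp ug up lg.
Qed.

Definition tdist x y := size (gpath x y).

Lemma on_geod_mem x y w : on_geod e x y w = (w \in x :: gpath x y).
Proof.
have [pg lg ug] := gpathP x y.
apply/asboolP/idP => [[p [pp lp up wp]]|wg]; last by exists (gpath x y).
by rewrite -lp gpath_unique.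
Qed.

Lemma tdist_path x p : path e x p -> tdist x (last x p) <= size p.
Proof.
case/shortenP => q pq uq sub; rewrite /tdist gpath_unique //.
by apply: uniq_leq_size sub; case/andP: uq.
Qed.

Lemma tdist_triangle x y z : tdist x z <= tdist x y + tdist y z.
Proof.
have [p1 l1 _] := gpathP x y; have [p2 l2 _] := gpathP y z.
rewrite -size_cat -{1}l2 -{1}l1 -last_cat; apply: tdist_path.
by rewrite cat_path p1 l1.
Qed.

Lemma tdist_sym x y : tdist x y = tdist y x.
Proof.
suff le a b : tdist a b <= tdist b a by apply/eqP; rewrite eqn_leq !le.
have [p l u] := gpathP b a.
have := @tdist_path (last b (gpath b a)) (rev (belast b (gpath b a))).
rewrite rev_path (eq_path (e' := e)); last by move=> s t; rewrite /= tree_sym.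
move=> /(_ p); rewrite size_rev size_belast l.
suff -> : last a (rev (belast b (gpath b a))) = b by [].
case E: (gpath b a) l => [|s q] /= l; first by [].
by rewrite rev_cons last_rcons.
Qed.

Lemma tdist_eq0 x y : (tdist x y == 0) = (x == y).
Proof.
rewrite /tdist; have [p l u] := gpathP x y.
apply/idP/eqP => [/eqP/size0nil E|E]; first by rewrite E in l.
suff -> : gpath x y = [::] by [].
by rewrite -E -{2}[x]/(last x [::]) gpath_unique.
Qed.

Lemma tdistxx x : tdist x x = 0. Proof. by apply/eqP; rewrite tdist_eq0. Qed.

Lemma tdist_edge x y : e x y -> tdist x y = 1.
Proof.
move=> exy; have xy : x != y by apply: contraTneq exy => ->; rewrite tree_irr.
by rewrite /tdist (@gpath_unique x [:: y]) //= ?inE ?xy ?exy.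
Qed.

Lemma gpath_split x y w : w \in x :: gpath x y ->
  gpath x y = gpath x w ++ gpath w y.
Proof.
have [] := gpathP x y; move: (gpath x y) => p pp lp up wp.
case/splitPl: wp pp lp up => p1 p2 wE.
rewrite last_cat wE cat_path -cat_cons cat_uniq /= wE => /andP[pp1 pp2] l2 /and3P[u1 h u2].
have -> : gpath x w = p1 by rewrite -wE gpath_unique.
suff -> : gpath w y = p2 by [].
rewrite -l2 gpath_unique //= u2 andbT; apply/negP => wp2.
by case/negP: h; apply/hasP; exists w => //=; rewrite -wE mem_last.
Qed.

(** Betweenness becomes an equation of distances, so later facts reduce to triangle inequalities.
    For the converse, the two geodesics joined at [w] have the minimal length, so making them simple
    loses no vertex. *)
Lemma on_geodE x y w : on_geod e x y w = (tdist x w + tdist w y == tdist x y).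
Proof.
rewrite on_geod_mem; apply/idP/eqP => [/gpath_split E|E].
  by rewrite /tdist E size_cat.
have [p1 l1 _] := gpathP x w; have [p2 l2 _] := gpathP w y.
have pc : path e x (gpath x w ++ gpath w y) by rewrite cat_path p1 l1.
have lc : last x (gpath x w ++ gpath w y) = y by rewrite last_cat l1.
have wc : w \in x :: gpath x w ++ gpath w y by rewrite -cat_cons mem_cat -{1}l1 mem_last.
have szc : size (gpath x w ++ gpath w y) = tdist x y by rewrite size_cat.
move: pc lc wc szc; move: (_ ++ _) => p.
case/shortenP=> q pq uq sub lq.
rewrite -lq /tdist gpath_unique // => + szq.
have sub' : {subset x :: q <= x :: p}.
  by move=> s; rewrite !inE => /orP[->//|/sub ->]; exact: orbT.
have szpq : size (x :: p) <= size (x :: q) by rewrite /= szq.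
by have [_ ->] := uniq_min_size uq sub' szpq.
Qed.

Lemma on_geod_split x y v w : on_geod e x y v -> on_geod e x y w ->
  on_geod e x v w || on_geod e v y w.
Proof.
move=> gv; rewrite !on_geod_mem; move: (gv); rewrite on_geod_mem => /gpath_split ->.
rewrite -cat_cons mem_cat => /orP[->//|h].
by rewrite [X in _ || X]inE h !orbT.
Qed.

(** If [z] is off the geodesic from [v] to [t], putting [z] in front of it yields the geodesic from
    [z], which passes through [v]. *)
Lemma on_geod_edge v z t : e v z -> on_geod e v t z = ~~ on_geod e z t v.
Proof.
move=> evz; have dvz := tdist_edge evz.
have dzv : tdist z v = 1 by rewrite tdist_sym.
apply/idP/idP => [|]; first by rewrite !on_geodE; lia.
apply: contraR; rewrite on_geod_mem => zp.
have [pp lp up] := gpathP v t.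
have := @gpath_unique z (v :: gpath v t); rewrite [last _ _]/= lp on_geod_mem => ->.
- by rewrite !inE eqxx orbT.
- by rewrite /= tree_sym evz.
- by rewrite cons_uniq zp.
Qed.

Lemma next_vertex v t : v != t -> exists2 z, e v z & on_geod e v t z.
Proof.
move=> vt; have [pp lp up] := gpathP v t.
case E: (gpath v t) pp lp => [|z p] /=; first by move=> _ vE; rewrite vE eqxx in vt.
by case/andP => evz _ _; exists z => //; rewrite on_geod_mem E !inE eqxx orbT.
Qed.

Lemma next_vertex_unique v t z z' : e v z -> e v z' ->
  on_geod e v t z -> on_geod e v t z' -> z = z'.
Proof.
move=> /tdist_edge d1 /tdist_edge d2 g1 g2; apply/eqP; rewrite -tdist_eq0.
have := on_geod_split g1 g2; move: g1 g2; rewrite !on_geodE.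
have := tdist_sym z z'; lia.
Qed.

End Tree.

(** * The numbers ell *)

Section SpliceTree.
Local Open Scope nat_scope.
Variables (V : finType) (e : rel V).
Hypothesis splice_e : is_splice_tree e.

Lemma splice_is_tree : is_tree e. Proof. by case: splice_e. Qed.
Local Notation treeP := splice_is_tree.
Local Notation D := (tdist treeP).

Lemma on_geod_sym x y w : on_geod e x y w = on_geod e y x w.
Proof. by rewrite !(on_geodE treeP) addnC !(tdist_sym treeP w) (tdist_sym treeP x y). Qed.

Lemma on_geod_l x y : on_geod e x y x.
Proof. by rewrite (on_geodE treeP) tdistxx. Qed.

Lemma on_geod_r x y : on_geod e x y y.
Proof. by rewrite on_geod_sym on_geod_l. Qed.

Lemma on_geodxx x y : on_geod e x x y = (y == x).
Proof.
rewrite (on_geodE treeP) tdistxx -(tdist_eq0 treeP) (tdist_sym treeP x).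
by rewrite addnn double_eq0.
Qed.

(** Nodes are only required to have valency other than 1; valency 0 is excluded by connectedness,
    valency 2 by the definition of a splice tree. *)
Lemma node_valency v : is_node e v -> 2 < valency e v.
Proof.
case: splice_e => _ [v0 hv0] /(_ v) n2 n1.
have [->//|vv0] := eqVneq v v0.
have [z evz _] := next_vertex treeP vv0.
have : 0 < valency e v by rewrite card_gt0; apply/set0Pn; exists z; rewrite inE.
by move: n1 n2; rewrite /is_node; lia.
Qed.

Lemma leaf_neighbor_unique v x y : is_leaf e v -> e v x -> e v y -> x = y.
Proof.
rewrite /is_leaf => /cards1P[z zE] ex ey.
have : x \in [set u | e v u] by rewrite inE.
have : y \in [set u | e v u] by rewrite inE.
by rewrite zE !inE => /eqP-> /eqP->.
Qed.

(** The single neighbour of a leaf would be the next vertex towards both ends, and bypassing the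
    leaf would shorten the geodesic. *)
Lemma interior_is_node u t v :
  on_geod e u t v -> v != u -> v != t -> is_node e v.
Proof.
move=> guv vu vt; apply/negP => lv.
have [x ex gx] := next_vertex treeP vu.
have [y ey gy] := next_vertex treeP vt.
have xy := leaf_neighbor_unique lv ex ey; subst y.
have := tdist_triangle treeP u x t; have := tdist_edge treeP ex.
move: guv gx gy; rewrite !(on_geodE treeP).
have := tdist_sym treeP x u; have := tdist_sym treeP v u; lia.
Qed.

(** For an edge [e x z], [on_geod e x t z] says that [t] lies in the branch at [x] through [z].
    Branches are nested, which drives the later inductions. *)
Lemma branch_sub x z z' t : e x z -> e z z' -> z' != x ->
  on_geod e z t z' -> on_geod e x t z.
Proof.
move=> exz ezz' z'x g; rewrite (on_geod_edge treeP) //.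
apply: contra z'x => gx; apply/eqP; apply: (next_vertex_unique treeP ezz' _ g gx).
by rewrite (tree_sym treeP).
Qed.

Lemma branch_disjoint x z z' t : e x z -> e x z' -> z != z' ->
  on_geod e x t z -> ~~ on_geod e x t z'.
Proof.
move=> ez ez' zz' g; apply: contra zz' => g'; apply/eqP.
exact: (next_vertex_unique treeP ez ez' g g').
Qed.

(** The geodesics from [u] to [z] and from [x] to [t] are joined by the edge; a common vertex would
    be closer to [z] than to [x] and conversely. *)
Lemma branch_apart x z u t : e x z -> on_geod e x u z ->
  ~~ on_geod e x t z -> on_geod e u t x.
Proof.
move=> ez gu gt.
have gt' : on_geod e z t x.
  by rewrite (on_geod_edge treeP) // (tree_sym treeP).
have [pu lu uu] := gpathP treeP u z.
have [pt lt ut] := gpathP treeP x t.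
set p := gpath treeP u z ++ x :: gpath treeP x t.
have pp : path e u p by rewrite cat_path pu lu /= (tree_sym treeP) ez.
have lp : last u p = t by rewrite last_cat.
have up : uniq (u :: p).
  rewrite -cat_cons cat_uniq uu ut andbT andTb; apply/hasPn => s.
  rewrite -on_geod_mem => gs'; apply/negP => /= gs; rewrite -on_geod_mem in gs.
  move: gu gt' gs gs'; rewrite !(on_geodE treeP) => gu gt' gs gs'.
  have dxz := tdist_edge treeP ez; have sy := tdist_sym treeP.
  have t1 := tdist_triangle treeP x s u; have t2 := tdist_triangle treeP z s t.
  move: gt' gs t1 t2; rewrite (sy z x) (sy u s) (sy u z) (sy z s); lia.
rewrite (on_geod_mem treeP) -lp (gpath_unique treeP) //.
by rewrite !(inE, mem_cat) eqxx !orbT.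
Qed.

Lemma ell_sym d u v : ell e d u v = ell e d v u.
Proof.
rewrite /ell; apply: eq_big => [w|w _]; first by rewrite on_geod_sym.
by apply: eq_bigl => x; rewrite on_geod_sym.
Qed.

Lemma ell_diag d v : is_node e v -> ell e d v v = dv e d v.
Proof.
move=> nv; rewrite /ell (big_pred1 v) => [|w]; last first.
  by rewrite on_geodxx /=; case: eqP => [->|]; rewrite ?nv ?andbF.
apply: eq_bigl => x; rewrite on_geodxx.
by case: eqP => [->|]; rewrite ?andbT // (tree_irr treeP).
Qed.

(** With 0/1 exponents over all pairs, identities between products become identities of exponents,
    checked one pair at a time. *)
Lemma ellE d u t : ell e d u t =
  \prod_w \prod_x d w x ^ [&& is_node e w, on_geod e u t w, e w x & ~~ on_geod e u t x].
Proof.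
rewrite /ell big_mkcond; apply: eq_bigr => w _.
case: (is_node e w) => /=; last by rewrite big1.
case: (on_geod e u t w) => /=; last by rewrite big1.
by rewrite big_mkcond; apply: eq_bigr => x _; case: ifP => _; rewrite ?expn1.
Qed.

Lemma dvE d v : dv e d v = \prod_w \prod_x d w x ^ ((w == v) && e w x).
Proof.
rewrite /dv [RHS](bigD1 v) //= [X in _ = _ * X]big1 => [|w /negbTE->]; last first.
  by rewrite big1.
rewrite muln1 big_mkcond; apply: eq_bigr => x _.
by rewrite eqxx /=; case: ifP; rewrite ?expn1.
Qed.

Lemma on_geod_through u t v w : on_geod e u t v ->
  on_geod e u t w = on_geod e u v w || on_geod e v t w.
Proof.
move=> gv; apply/idP/idP => [gw|]; first exact: (on_geod_split treeP).
have := tdist_triangle treeP u w t; move: gv; rewrite !(on_geodE treeP).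
have := tdist_triangle treeP u v w; have := tdist_triangle treeP w v t.
have := tdist_sym treeP v w; lia.
Qed.

Lemma on_geod_meet u t v w : on_geod e u t v ->
  on_geod e u v w -> on_geod e v t w -> w = v.
Proof.
rewrite !(on_geodE treeP) => gv gw gw'; apply/eqP; rewrite -(tdist_eq0 treeP).
have := tdist_triangle treeP u w t; have := tdist_sym treeP v w; lia.
Qed.

Lemma on_geod_step u t v w x : on_geod e u t v -> on_geod e u v w ->
  e w x -> w != v -> on_geod e v t x -> on_geod e u v x.
Proof.
move=> gv gw ewx wv gx; have d1 := tdist_edge treeP ewx.
suff /eqP -> : x == v by rewrite on_geod_r.
have : tdist treeP w v != 0 by rewrite (tdist_eq0 treeP).
rewrite -(tdist_eq0 treeP); move: gv gw gx; rewrite !(on_geodE treeP).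
have := tdist_triangle treeP u w t; have := tdist_triangle treeP w x t.
have := tdist_sym treeP v x; lia.
Qed.

(* The edges leaving [u,t] are counted by those leaving [u,v] and [v,t], which
   count all edges at v once too often. *)
Lemma ell_through d u t v : is_node e v -> on_geod e u t v ->
  ell e d u t * dv e d v = ell e d u v * ell e d v t.
Proof.
move=> nv gv; rewrite !ellE dvE -!big_split; apply: eq_bigr => w _ /=.
rewrite -!big_split; apply: eq_bigr => x _ /=; rewrite -!expnD; congr (_ ^ _).
have [ewx|newx] := boolP (e w x); last by rewrite !andbF.
have gv' : on_geod e t u v by rewrite on_geod_sym.
rewrite !(on_geod_through _ gv).
(* At [w = v] the factor [dv] supplies the missing unit, since no neighbour of [v] lies on both
   halves. Any other [w] is on at most one half, and by [on_geod_step] a neighbour of it on the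
   other half is on its own half too. *)
have [wv|wv] := eqVneq w v.
  subst w; rewrite nv on_geod_l on_geod_r /=.
  have := @on_geod_meet u t v x gv.
  case: (on_geod e u v x) => //=; case: (on_geod e v t x) => //= /(_ isT isT) xv.
  by rewrite xv (tree_irr treeP) in ewx.
case: (is_node e w) => //=.
have m := @on_geod_meet u t v w gv.
have s1 := fun g g' => @on_geod_step u t v w x gv g ewx wv g'.
have s2 : on_geod e v t w -> on_geod e u v x -> on_geod e v t x.
  move=> g g'; rewrite on_geod_sym; apply: (on_geod_step gv' _ ewx wv).
    by rewrite on_geod_sym.
  by rewrite on_geod_sym.
move: m s1 s2.
case: (on_geod e u v w) (on_geod e v t w) => [] [] //= m s1 s2.
- by rewrite m // eqxx in wv.
- by rewrite !addn0; case: (on_geod e v t x) s1 => [->//|_]; rewrite orbF.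
- by rewrite !addn0 add0n; case: (on_geod e u v x) s2 => [->//|].
Qed.

Lemma ell_edge d u v : is_node e u -> is_node e v -> e u v ->
  ell e d u v * (d u v * d v u) = dv e d u * dv e d v.
Proof.
move=> nu nv euv; have d1 := tdist_edge treeP euv.
have uv : u != v by apply: contraTneq euv => ->; rewrite (tree_irr treeP).
have gE w : on_geod e u v w = (w == u) || (w == v).
  apply/idP/idP => [|/orP[]/eqP->]; rewrite ?on_geod_l ?on_geod_r //.
  rewrite (on_geodE treeP) d1 -!(tdist_eq0 treeP) (tdist_sym treeP w u); lia.
have step w y : e w y -> (forall x, e w x -> (x == u) || (x == v) = (x == y)) ->
    dv e d w = d w y * \prod_(x | e w x && ~~ on_geod e u v x) d w x.
  move=> wy h; rewrite /dv (bigD1 y) //=; congr (_ * _); apply: eq_bigl => x.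
  by case E: (e w x) => //=; rewrite gE h.
have evu : e v u by rewrite (tree_sym treeP).
have su x : e u x -> (x == u) || (x == v) = (x == v).
  by move=> eux; case: (x =P u) => [xu|//]; rewrite xu (tree_irr treeP) in eux.
have sv x : e v x -> (x == u) || (x == v) = (x == u).
  move=> evx; case: (x =P v) => [xv|]; last by rewrite orbF.
  by rewrite xv (tree_irr treeP) in evx.
rewrite (step u v euv su) (step v u evu sv).
rewrite /ell; set A := fun w => \prod_(x | e w x && ~~ on_geod e u v x) d w x.
rewrite (eq_bigr A) // -/(A u) -/(A v).
rewrite (bigD1 u) ?nu ?on_geod_l // (bigD1 v) ?nv ?on_geod_r 1?eq_sym ?uv //.
rewrite /= big1 => [|w]; last first.
  by rewrite gE; case: (w == u); case: (w == v); rewrite ?andbF.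
by rewrite muln1; lia.
Qed.

Variable d : V -> V -> nat.
Hypothesis d_gt0 : positive_weights e d.

Lemma ell_gt0 u v : 0 < ell e d u v.
Proof.
rewrite /ell; apply: prodn_cond_gt0 => w /andP[nw _].
by apply: prodn_cond_gt0 => x /andP[ewx _]; exact: d_gt0.
Qed.

Lemma dv_gt0 v : is_node e v -> 0 < dv e d v.
Proof. by move=> nv; rewrite -ell_diag ?ell_gt0. Qed.

Hypothesis d_det : edge_determinant e d.

(** This is the edge determinant condition multiplied by [ell e d u v], which removes the edge
    weights. *)
Lemma ell_edge_lt u v : is_node e u -> is_node e v -> e u v ->
  ell e d u v * ell e d u v < dv e d u * dv e d v.
Proof.
move=> nu nv euv; rewrite -(ell_edge d nu nv euv) ltn_pmul2l ?ell_gt0 //.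
exact: d_det.
Qed.

Lemma tdist_step x z u u' : e x z -> on_geod e x u z -> e u u' ->
  on_geod e u x u' -> u' != x ->
  on_geod e x u' z /\ (tdist treeP x u' < tdist treeP x u).
Proof.
move=> exz gu eu' gu' u'x.
have dz := tdist_edge treeP exz; have du := tdist_edge treeP eu'.
have gxu' : on_geod e x u u' by rewrite on_geod_sym.
split; last by move: gxu'; rewrite (on_geodE treeP) (tdist_sym treeP u' u); lia.
have /orP[//|] := on_geod_split treeP gxu' gu.
rewrite (on_geodE treeP) (tdist_sym treeP u' u) du => h.
have [->|zu'] := eqVneq z u'; first by rewrite on_geod_r.
have zu : z == u.
  rewrite -(tdist_eq0 treeP); move: zu' h.
  by rewrite -(tdist_eq0 treeP) (tdist_sym treeP z u'); lia.
move/eqP: zu => zu; subst z; move: gxu' u'x; rewrite (on_geodE treeP) -(tdist_eq0 treeP).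
by rewrite (tdist_sym treeP u' x) (tdist_sym treeP u' u); lia.
Qed.

(** Induction on the distance from [x] to [u], moving [u] one edge towards [x], to [u']. This
    spreads the edge determinant condition from one edge to a whole branch. *)
Lemma ell_lt x z u l : is_node e x -> is_node e u -> e x z ->
  on_geod e x u z -> on_geod e x l z ->
  ell e d u x * ell e d x l < ell e d u l * dv e d x.
Proof.
move=> nx + ez; have [n] := ubnP (tdist treeP x u).
elim: n u => // n IH u ltn nu gu gl.
have ux : u != x.
  apply: contraTneq gu => ->; rewrite on_geodxx; apply: contraTneq ez => ->.
  by rewrite (tree_irr treeP).
have [u' eu' gu'] := next_vertex treeP ux.
have [u'x|u'x] := eqVneq u' x.
  (* Here [u = z], and [u] lies between [x] and [l]: after multiplication by [dv e d u] the claim is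
     [ell_edge_lt]. *)
  subst u'.
  have uz : z = u.
    apply: (next_vertex_unique treeP ez _ gu); last by rewrite on_geod_r.
    by rewrite (tree_sym treeP).
  subst z; have := ell_edge_lt nu nx eu'; have := ell_through d nu gl.
  rewrite (ell_sym d x u); have := ell_gt0 u l; have := dv_gt0 nu.
  move: (ell e d u x) (ell e d x l) (ell e d u l) (dv e d x) (dv e d u) => a b c y w.
  move=> w0 c0 E lt; rewrite -(ltn_pmul2r w0) -mulnA E.
  have : a * a * c < w * y * c by rewrite ltn_pmul2r.
  have -> : a * (a * c) = a * a * c by ring.
  by have -> : w * y * c = c * y * w by ring.
have u'u : u' != u by apply: contraTneq eu' => ->; rewrite (tree_irr treeP).
have nu' := interior_is_node gu' u'u u'x.
have [gzu' ltu'] := tdist_step ez gu eu' gu' u'x.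
have IHu := IH u' (leq_trans ltu' ltn) nu' gzu' gl.
have Ex := ell_through d nu' gu'.
(* If [u'] is also on the way to [l], passing from [u'] to [u] scales both sides by
   [ell e d u u' / dv e d u']. *)
have [gl'|gl'] := boolP (on_geod e u l u').
  have := ell_through d nu' gl'; move: IHu Ex (ell_gt0 u u') (dv_gt0 nu').
  move: (ell e d u x) (ell e d u u') (ell e d u' x) (ell e d u l) => a b c f.
  move: (ell e d x l) (ell e d u' l) (dv e d x) (dv e d u') => g h i k.
  move=> lt E1 b0 k0 E2; rewrite -(ltn_pmul2r k0).
  have : c * g * b < h * i * b by rewrite ltn_pmul2r.
  have -> : a * g * k = (a * k) * g by ring.
  have -> : f * i * k = (f * k) * i by ring.
  rewrite E1 E2; have -> : c * g * b = b * c * g by ring.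
  by have -> : h * i * b = b * h * i by ring.
(* Otherwise [u] lies between [u'] and [l], and the induction hypothesis is combined with
   [ell_edge_lt] for the edge from [u] to [u']. *)
rewrite (on_geod_edge treeP) // negbK in gl'.
have := ell_through d nu gl'; move: IHu Ex (ell_gt0 u u') (dv_gt0 nu') (dv_gt0 nu).
have := ell_edge_lt nu nu' eu'; rewrite (ell_sym d u' u).
have := ell_gt0 u l; have := dv_gt0 nx.
move: (ell e d u x) (ell e d u u') (ell e d u' x) (ell e d u l) => a b c f.
move: (ell e d x l) (ell e d u' l) (dv e d x) (dv e d u') (dv e d u) => g h i k j.
move=> i0 f0 lt0 lt E1 b0 k0 j0 E2; rewrite -(ltn_pmul2r k0) -(ltn_pmul2r j0).
have -> : a * g * k * j = (a * k) * g * j by ring.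
have -> : f * i * k * j = j * k * (f * i) by ring.
have l1 : c * g * (b * j) < h * i * (b * j) by rewrite ltn_pmul2r // muln_gt0 b0.
have l2 : b * b * (f * i) < j * k * (f * i) by rewrite ltn_pmul2r // muln_gt0 f0.
apply: leq_ltn_trans l2; rewrite E1.
have -> : b * c * g * j = c * g * (b * j) by ring.
apply: leq_trans (ltnW l1) _.
have -> : h * i * (b * j) = (h * j) * (i * b) by ring.
by rewrite E2; have -> : b * f * (i * b) = b * b * (f * i) by ring.
Qed.
End SpliceTree.

(** * Weights, excess and filled branches *)

Section Weights.
Variables (V : finType) (e : rel V) (d : V -> V -> nat) (R : realType).
Hypothesis diag : splice_diagram e d.
Hypothesis d_det : edge_determinant e d.
Variable alpha : V -> V -> leafT e -> nat.
Hypothesis alphaP : forall v x, is_node e v -> e v x -> @admissible V e d v x (alpha v x).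

Local Notation L := (leafT e).
Local Notation W := (@wvec V e d R).
Local Notation mvx := (mvx alpha).
Let spl : is_splice_tree e := proj1 diag.
Let d_gt0 : positive_weights e d := proj2 diag.
Let treeP := splice_is_tree spl.

Lemma alpha_branch x z (l : L) : is_node e x -> e x z ->
  (0 < alpha x z l)%N -> on_geod e x (val l) z.
Proof. by move=> nx ez; rewrite lt0n; have [h _] := alphaP nx ez; apply: h. Qed.

Lemma alpha_exists x z : is_node e x -> e x z -> exists l : L, (0 < alpha x z l)%N.
Proof.
move=> nx ez; apply/existsP; apply: contraT => /existsPn h.
have [_ E] := alphaP nx ez; have := dv_gt0 spl d_gt0 nx.
rewrite E big1 // => l _.
by have := h l; rewrite lt0n negbK => /eqP->.
Qed.

(** Every leaf in the monomial is separated from [u] by [x], so [ell_through] applies termwise; the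
    remaining sum is [dv e d x] by admissibility. *)
Lemma nweight_apart x z u : is_node e x -> e x z -> ~~ on_geod e x u z ->
  nweight d u (mvx x z) = ell e d u x.
Proof.
move=> nx ez gu; have d0 := dv_gt0 spl d_gt0 nx.
apply/eqP; rewrite -(eqn_pmul2r d0) {2}(alphaP nx ez).2 big_distrl big_distrr /=.
apply/eqP/eq_bigr => l _; rewrite ffunE.
have [->|al] := posnP (alpha x z l); first by rewrite /= muln0 mul0n muln0.
have gl := alpha_branch nx ez al.
have := ell_through spl d nx (branch_apart spl ez gl gu).
rewrite (ell_sym spl d (val l) u) (ell_sym spl d (val l) x) (ell_sym spl d x u).
by move=> E; rewrite mulnAC E; ring.
Qed.

(** As in [nweight_apart], with [ell_lt] for the leaves that occur; at least one occurs, so the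
    inequality is strict. *)
Lemma nweight_branch x z u : is_node e x -> e x z -> is_node e u ->
  on_geod e x u z -> (ell e d u x < nweight d u (mvx x z))%N.
Proof.
move=> nx ez nu gu; have d0 := dv_gt0 spl d_gt0 nx.
rewrite -(ltn_pmul2r d0) {1}(alphaP nx ez).2 big_distrl big_distrr /=.
have [l0 al0] := alpha_exists nx ez.
have lt l : (0 < alpha x z l)%N ->
    (ell e d u x * (alpha x z l * ell e d x (val l)) <
     ell e d u (val l) * mvx x z l * dv e d x)%N.
  move=> al; have gl := alpha_branch nx ez al.
  have := ell_lt spl d_gt0 d_det nx nu ez gu gl; rewrite ffunE -(ltn_pmul2r al).
  by congr (_ < _)%N; ring.
rewrite (bigD1 l0) //= [X in (_ < X)%N](bigD1 l0) //=.
rewrite -addSn leq_add ?lt // leq_sum // => l _.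
have [->|al] := posnP (alpha x z l); first by rewrite mul0n muln0.
exact: ltnW (lt l al).
Qed.

(* The common value of [w_u . m_{x,z}] over the edges [{x,z}] at the node [x] that
   do not lead to [u]. *)
Definition lcoef u x : R := if is_leaf e u then 0 else (ell e d u x)%:R.

Lemma wdot_node u m : is_node e u -> wdot (W u) m = (nweight d u m)%:R.
Proof.
rewrite /is_node => nu; rewrite /wdot /nweight natr_sum; apply: eq_bigr => l _.
by rewrite /wvec /is_leaf (negbTE nu) natrM.
Qed.

Lemma wdot_leaf (l : L) m : wdot (W (val l)) m = (m l)%:R.
Proof.
rewrite /wdot (bigD1 l) //= big1 ?addr0 => [|l' ll'].
  by rewrite /wvec (valP l) eqxx mul1r.
by rewrite /wvec (valP l) (inj_eq val_inj) (negbTE ll') mul0r.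
Qed.

Lemma leafP u : is_leaf e u -> exists l : L, u = val l.
Proof. by move=> lu; exists (exist _ u lu). Qed.

Lemma wdot_apart x z u : is_node e x -> e x z -> ~~ on_geod e x u z ->
  wdot (W u) (mvx x z) = lcoef u x.
Proof.
move=> nx ez gu; rewrite /lcoef; have [lu|nu] := boolP (is_leaf e u).
  have [l E] := leafP lu; subst u; rewrite wdot_leaf ffunE.
  by have [->//|/(alpha_branch nx ez) gl] := posnP (alpha x z l); rewrite gl in gu.
by rewrite wdot_node // nweight_apart.
Qed.

Lemma wdot_branch x z u : is_node e x -> e x z -> is_node e u ->
  on_geod e x u z -> lcoef u x < wdot (W u) (mvx x z).
Proof.
move=> nx ez nu gu; rewrite wdot_node // /lcoef ifN //.
by rewrite ltr_nat nweight_branch.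
Qed.

Lemma wdot_ge_lcoef x z u : is_node e x -> e x z ->
  lcoef u x <= wdot (W u) (mvx x z).
Proof.
move=> nx ez; have [gu|gu] := boolP (on_geod e x u z); last by rewrite wdot_apart.
have [lu|nu] := boolP (is_leaf e u); last exact: ltW (wdot_branch nx ez nu gu).
by have [l E] := leafP lu; subst u; rewrite wdot_leaf /lcoef lu ler0n.
Qed.

Lemma wdot_sum (J : finType) (b : J -> R) (w : J -> L -> R) m :
  wdot (fun l => \sum_j b j * w j l) m = \sum_j b j * wdot (w j) m.
Proof.
rewrite /wdot; under eq_bigr do rewrite big_distrl /=.
rewrite exchange_big /=; apply: eq_bigr => j _.
by rewrite big_distrr /=; apply: eq_bigr => l _; rewrite mulrA.
Qed.

Lemma sum_lt_exists (J : finType) (F G : J -> R) :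
  \sum_j F j < \sum_j G j -> exists j, F j < G j.
Proof.
move=> lt; apply: contrapT => hn; move: lt; apply/negP; rewrite -leNgt.
by apply: ler_sum => j _; rewrite leNgt; apply/negP => lt; apply: hn; exists j.
Qed.

(** * Excess and cones of weight vectors, for a fixed nonnegative combination *)

Section Decomposition.
Variable a : V -> R.
Hypothesis a_ge0 : forall u, 0 <= a u.
Let p : L -> R := fun l => \sum_u a u * W u l.
(** A lower bound for the [p]-weights of the monomials at [x]; it is attained exactly on the
    branches without excess. *)
Definition min_weight x := \sum_u a u * lcoef u x.
(* The monomial [z^{m_{x,z}}] does not occur in the [p]-initial form of [f_{x,i}]. *)
Definition excess x z := min_weight x < wdot p (mvx x z).

Lemma min_weight_le x z : is_node e x -> e x z -> min_weight x <= wdot p (mvx x z).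
Proof.
by move=> nx ez; rewrite wdot_sum; apply: ler_sum => u _; rewrite ler_wpM2l // wdot_ge_lcoef.
Qed.

Lemma excess_intro x z u : is_node e x -> e x z -> 0 < a u ->
  lcoef u x < wdot (W u) (mvx x z) -> excess x z.
Proof.
move=> nx ez au lt; rewrite /excess wdot_sum /min_weight (bigD1 u) //=.
rewrite [X in _ < X](bigD1 u) //= ltr_leD ?ltr_pM2l // ler_sum // => v _.
by rewrite ler_wpM2l // wdot_ge_lcoef.
Qed.

Lemma excess_elim x z : is_node e x -> e x z -> excess x z ->
  exists u, [/\ 0 < a u, on_geod e x u z & lcoef u x < wdot (W u) (mvx x z)].
Proof.
move=> nx ez; rewrite /excess wdot_sum => /sum_lt_exists[u].
have [au|au] := ltrP 0 (a u); last first.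
  by have -> : a u = 0; [apply/eqP; rewrite eq_le au a_ge0|rewrite !mul0r ltxx].
rewrite ltr_pM2l // => lt; exists u; split=> //.
by apply: contraTT lt => gu; rewrite wdot_apart // ltxx.
Qed.

Definition branch_part x z (l : L) : R := if on_geod e x (val l) z then W x l else 0.

(** Modulo adding a multiple of [W x], the part of [W x] on this branch lies in the cone of the
    support vectors from the branch. The multiple [q] is harmless: summed over all branches, the
    parts give back [W x]. *)
Definition filled x z := exists (q : R) (b : V -> R),
  [/\ 0 <= q, forall u, 0 <= b u, forall u, b u != 0 -> 0 < a u /\ on_geod e x u z &
      forall l, branch_part x z l + q * W x l = \sum_u b u * W u l].

Lemma wdotD (w1 w2 : L -> R) m : wdot (fun l => w1 l + w2 l) m = wdot w1 m + wdot w2 m.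
Proof. by rewrite /wdot -big_split; apply: eq_bigr => l _; rewrite mulrDl. Qed.

Lemma wdotZ k (w : L -> R) m : wdot (fun l => k * w l) m = k * wdot w m.
Proof. by rewrite /wdot big_distrr; apply: eq_bigr => l _; rewrite -mulrA. Qed.

Lemma other_neighbor x z : is_node e x -> exists2 z', e x z' & z' != z.
Proof.
move=> /(node_valency spl) h.
have : (0 < #|[set u | e x u] :\ z|)%N by move: h; rewrite /valency (cardsD1 z); lia.
by rewrite card_gt0 => /set0Pn[z']; rewrite !inE => /andP[]; exists z'.
Qed.

Lemma edge_neq x z : e x z -> z != x.
Proof. by move=> ez; apply: contraTneq ez => ->; rewrite (tree_irr treeP). Qed.

Lemma lcoef_diag x : is_node e x -> 0 < lcoef x x.
Proof. by move=> nx; rewrite /lcoef ifN // ltr0n (ell_gt0 d_gt0). Qed.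

(** Pair the identity of [filled] with the monomials of [z] and of another neighbour [z']. The
    branch part has weight [lcoef x x] on the first and 0 on the second, while [W x] does not
    separate them; so some support vector weighs more on the first. *)
Lemma filled_excess x z : is_node e x -> e x z -> filled x z -> excess x z.
Proof.
move=> nx ez [q [b [q0 b0 bP E]]].
have [z' ez' z'z] := other_neighbor z nx.
have nxx y : e x y -> ~~ on_geod e x x y by move=> ey; rewrite on_geodxx // edge_neq.
have E1 : wdot (branch_part x z) (mvx x z) = lcoef x x.
  rewrite -(wdot_apart nx ez (nxx z ez)); apply: eq_bigr => l _; rewrite ffunE.
  have [->|al] := posnP (alpha x z l); first by rewrite !mulr0.
  by rewrite /branch_part (alpha_branch nx ez al).
have E2 : wdot (branch_part x z) (mvx x z') = 0.
  rewrite /wdot big1 // => l _; rewrite ffunE.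
  have [->|al] := posnP (alpha x z' l); first by rewrite mulr0.
  rewrite /branch_part ifN ?mul0r //.
  exact: branch_disjoint ez' ez z'z (alpha_branch nx ez' al).
have F m : wdot (branch_part x z) m + q * wdot (W x) m = \sum_u b u * wdot (W u) m.
  by rewrite -wdot_sum -wdotZ -wdotD; apply: eq_bigr => l _; rewrite E.
have := F (mvx x z); have := F (mvx x z').
rewrite E1 E2 !wdot_apart ?nxx // add0r => F2 F1.
have /sum_lt_exists[u] : \sum_u b u * wdot (W u) (mvx x z') < \sum_u b u * wdot (W u) (mvx x z).
  by rewrite -F1 -F2 ltrDr lcoef_diag.
have [->|bu] := eqVneq (b u) 0; first by rewrite !mul0r ltxx.
have [au gu] := bP u bu.
rewrite ltr_pM2l; last by rewrite lt_neqAle eq_sym bu b0.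
move=> lt; apply: excess_intro au _ => //; apply: le_lt_trans lt.
exact: wdot_ge_lcoef.
Qed.

Lemma wvec_node x l : is_node e x -> W x l = (ell e d x (val l))%:R.
Proof. by rewrite /is_node => nx; rewrite /wvec /is_leaf (negbTE nx). Qed.

(** By [ell_through], [W z] is proportional to [W x] on each side of the edge, with ratio
    [dv z / ell x z] beyond [z] and [ell x z / dv x] behind [x]. The edge determinant condition
    makes the difference [q] of the ratios positive. *)
Lemma edge_relation x z : is_node e x -> is_node e z -> e x z ->
  exists p q r : R, [/\ 0 <= p, 0 < q, 0 < r,
    forall l, W z l = p * W x l + q * branch_part x z l &
    forall l, on_geod e x (val l) z -> W z l = r * W x l].
Proof.
move=> nx nz ez.
have dx : 0 < (dv e d x)%:R :> R by rewrite ltr0n (dv_gt0 spl).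
have dz : 0 < (dv e d z)%:R :> R by rewrite ltr0n (dv_gt0 spl).
have l0 : 0 < (ell e d x z)%:R :> R by rewrite ltr0n (ell_gt0 d_gt0).
have det : (ell e d x z)%:R * (ell e d x z)%:R < (dv e d x)%:R * (dv e d z)%:R :> R.
  by rewrite -!natrM ltr_nat; exact: ell_edge_lt.
have r0 : 0 < (dv e d z)%:R / (ell e d x z)%:R :> R by rewrite divr_gt0.
have rP l : on_geod e x (val l) z ->
    W z l = (dv e d z)%:R / (ell e d x z)%:R * W x l :> R.
  move=> gl; rewrite !wvec_node //; have := ell_through spl d nz gl.
  move/(congr1 (GRing.natmul (1 : R))); rewrite !natrM.
  by move=> E; rewrite mulrAC [X in X / _]mulrC E; field; rewrite gt_eqF.
exists ((ell e d x z)%:R / (dv e d x)%:R).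
exists ((dv e d z)%:R / (ell e d x z)%:R - (ell e d x z)%:R / (dv e d x)%:R).
exists ((dv e d z)%:R / (ell e d x z)%:R); split=> //.
- by rewrite divr_ge0 // ltW.
- by rewrite subr_gt0 ltr_pdivrMr // mulrAC ltr_pdivlMr // [X in _ < X]mulrC.
move=> l; rewrite /branch_part; case: ifPn => gl; first by rewrite rP //; ring.
rewrite (on_geod_edge treeP) // negbK in gl.
rewrite !wvec_node // mulr0 addr0; have := ell_through spl d nx gl.
move/(congr1 (GRing.natmul (1 : R))); rewrite !natrM (ell_sym spl d z x).
by move=> E; rewrite mulrAC -E; field; rewrite gt_eqF.
Qed.

Lemma leaf_branch x z y : is_leaf e z -> e x z -> on_geod e x y z -> y = z.
Proof.
move=> lz ez gy; apply/eqP; apply: contraTT lz => yz.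
by apply: (interior_is_node spl gy); rewrite 1?eq_sym // eq_sym edge_neq // .
Qed.

Lemma filled_support x z : is_node e x -> e x z -> 0 < a z -> filled x z.
Proof.
move=> nx ez az; have [lz|nz] := boolP (is_leaf e z).
  (* A leaf [z] is the whole branch, so the branch part is a multiple of its basis vector. *)
  exists 0, (fun u => if u == z then (ell e d x z)%:R else 0); split=> //.
  - by move=> u; case: ifP; rewrite ?ler0n.
  - by move=> u; case: (u =P z) => [->|]; rewrite ?eqxx ?on_geod_r.
  move=> l; rewrite mul0r addr0 (bigD1 z) //= eqxx big1 ?addr0 => [|u /negbTE->]; last first.
    by rewrite mul0r.
  rewrite /branch_part /(W z) lz.
  have [E|E] := eqVneq (val l) z.
    by rewrite E on_geod_r // wvec_node // E mulr1.
  rewrite mulr0 ifN //; apply: contra E => gl; apply/eqP.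
  exact: leaf_branch gl.
have [k [q [r [k0 q0 r0 E _]]]] := edge_relation nx nz ez.
(* For a node [z], these solve [edge_relation] for the branch part. *)
exists (k / q), (fun u => if u == z then q^-1 else 0); split=> //.
- by rewrite divr_ge0 // ltW.
- by move=> u; case: ifP; rewrite ?invr_ge0 // ltW.
- by move=> u; case: (u =P z) => [->|]; rewrite ?eqxx ?on_geod_r.
move=> l; rewrite (bigD1 z) //= eqxx big1 ?addr0 => [|u /negbTE->]; last first.
  by rewrite mul0r.
by rewrite E; field; rewrite gt_eqF.
Qed.

Lemma branch_unique x (l : L) : is_node e x ->
  exists2 z, e x z & forall z', e x z' -> on_geod e x (val l) z' = (z' == z).
Proof.
move=> nx; have xl : x != val l.
  by apply: contraNneq nx => ->; exact: valP l.
have [z ez gz] := next_vertex treeP xl; exists z => // z' ez'.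
apply/idP/eqP => [gz'|->//]; exact: (next_vertex_unique treeP ez' ez gz').
Qed.

(** Witnesses of [filled] are chosen for all branches in [P] at once and added up. *)
Lemma filled_choice (x : V) (P : pred V) : (forall z, P z -> filled x z) ->
  exists (Q : R) (b : V -> R), [/\ 0 <= Q, forall u, 0 <= b u,
    forall u, b u != 0 -> 0 < a u /\ exists2 z, P z & on_geod e x u z &
    forall l, \sum_(z | P z) branch_part x z l + Q * W x l = \sum_u b u * W u l].
Proof.
move=> fP.
have /choice[f fE] : forall z, exists qb : R * (V -> R), P z ->
    [/\ 0 <= qb.1, forall u, 0 <= qb.2 u,
     forall u, qb.2 u != 0 -> 0 < a u /\ on_geod e x u z &
      forall l, branch_part x z l + qb.1 * W x l = \sum_u qb.2 u * W u l].
  move=> z; have [/fP[q [b h]]|] := boolP (P z); first by exists (q, b).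
  by exists (0, fun=> 0).
exists (\sum_(z | P z) (f z).1), (fun u => \sum_(z | P z) (f z).2 u); split.
- by apply: sumr_ge0 => z /fE[].
- by move=> u; apply: sumr_ge0 => z /fE[].
- move=> u /eqP h; have [z [Pz hz]] : exists z, P z /\ (f z).2 u != 0.
    apply: contrapT => hn; apply: h; rewrite big1 // => z Pz.
    by apply: contrapT => /eqP hz; apply: hn; exists z.
  by have [_ _ /(_ u hz)[au gu] _] := fE z Pz; split=> //; exists z.
move=> l; rewrite big_distrl -big_split /=.
under [RHS]eq_bigr do rewrite big_distrl /=.
by rewrite exchange_big; apply: eq_bigr => z /fE[].
Qed.

(** The parts of [W z] on the branches other than that of [x] add up to [r] times the branch part of
    [W x]. With [W z] rewritten by [edge_relation], the branch part gets coefficient [r + Q * q] and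
    [W x] gets [Q * k]. *)
Lemma filled_node x z : is_node e x -> is_node e z -> e x z ->
  (forall z', e z z' -> z' != x -> filled z z') -> filled x z.
Proof.
move=> nx nz ez fz; have [k [q [r [k0 q0 r0 E Er]]]] := edge_relation nx nz ez.
have [|Q [b [Q0 b0 bP bE]]] := @filled_choice z [pred z' | e z z' && (z' != x)].
  by move=> z' /andP[]; exact: fz.
have S l : \sum_(z' | e z z' && (z' != x)) branch_part z z' l = r * branch_part x z l.
  have [y ey yP] := branch_unique l nz.
  have := yP x; rewrite (tree_sym treeP z x) => /(_ ez) gE.
  rewrite [in RHS]/branch_part (on_geod_edge treeP) // gE.
  have [xy|xy] /= := eqVneq x y.
    rewrite mulr0 big1 // => z' /andP[ez' z'x].
    by rewrite /branch_part yP // -xy (negbTE z'x).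
  rewrite (bigD1 y) /=; last by rewrite ey eq_sym xy.
  rewrite big1 => [|z' /andP[/andP[ez' _] /negbTE zy]]; last by rewrite /branch_part yP // zy.
  rewrite addr0 /branch_part yP // eqxx Er //.
  by rewrite (on_geod_edge treeP) // gE.
have rq0 : 0 < r + Q * q by rewrite ltr_wpDr // mulr_ge0 // ltW.
exists (Q * k / (r + Q * q)), (fun u => b u / (r + Q * q)); split.
- by rewrite divr_ge0 ?mulr_ge0 // ltW.
- by move=> u; rewrite divr_ge0 // ltW.
- move=> u h; have /bP[au [z' /andP[ez' z'x] gz']] : b u != 0.
    by apply: contraNneq h => ->; rewrite mul0r.
  by split=> //; apply: (branch_sub spl _ ez' z'x).
move=> l; under eq_bigr do rewrite mulrAC; rewrite -mulr_suml -bE S E.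
by field; rewrite gt_eqF.
Qed.

Lemma filled_all x : is_node e x -> (forall z, e x z -> filled x z) ->
  exists b : V -> R, [/\ forall u, 0 <= b u,
    forall u, b u != 0 -> 0 < a u /\ u != x &
    forall l, W x l = \sum_u b u * W u l].
Proof.
move=> nx fx; have [|Q [b [Q0 b0 bP bE]]] := @filled_choice x (e x); first exact: fx.
have S l : \sum_(z | e x z) branch_part x z l = W x l.
  have [y ey yP] := branch_unique l nx.
  rewrite (bigD1 y) //= big1 => [|z' /andP[ez' /negbTE zy]]; last by rewrite /branch_part yP // zy.
  by rewrite addr0 /branch_part yP // eqxx.
have Q1 : 0 < 1 + Q by rewrite ltr_wpDr.
exists (fun u => b u / (1 + Q)); split.
- by move=> u; rewrite divr_ge0 // ltW.
- move=> u h; have /bP[au [z ez gz]] : b u != 0.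
    by apply: contraNneq h => ->; rewrite mul0r.
  split=> //; apply: contraTneq gz => ->; rewrite on_geodxx //; exact: edge_neq.
move=> l; under eq_bigr do rewrite mulrAC; rewrite -mulr_suml -bE S.
by field; rewrite gt_eqF.
Qed.

Lemma support_excess x z s : is_node e x -> is_node e s -> 0 < a s ->
  e x z -> on_geod e x s z -> excess x z.
Proof.
by move=> nx ns as0 ez gs; apply: excess_intro as0 _ => //; exact: wdot_branch.
Qed.

(** * The support of an irredundant decomposition when excess propagates *)

Section Support.
Hypothesis excess_all : forall x z1 z2 z, is_node e x -> e x z1 -> e x z2 ->
  z1 != z2 -> excess x z1 -> excess x z2 -> e x z -> excess x z.

(** Induction on the size of the branch. At [z], the branch towards [t] is filled by induction and
    the branch back to [x] contains the node [s], so both have excess. Then all branches at [z] have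
    excess, hence meet the support, hence are filled by induction unless they lead to [x];
    [filled_node] concludes. *)
Lemma filled_of_support s x z t : is_node e s -> 0 < a s ->
  is_node e x -> e x z -> ~~ on_geod e x s z -> 0 < a t -> on_geod e x t z ->
  filled x z.
Proof.
move=> ns as0; have [n] := ubnP #|[set y | on_geod e x y z]|.
elim: n x z t => // n IH x z t ltn nx ez gs at0 gt.
have [az|az] := ltrP 0 (a z); first exact: filled_support.
have zt : z != t by apply: contraTneq at0 => <-; rewrite -leNgt.
have nz := interior_is_node spl gt (edge_neq ez) zt.
have ezx : e z x by rewrite (tree_sym treeP).
have [z1 ez1 gt1] := next_vertex treeP zt.
have z1x : z1 != x.
  by apply: contraTneq gt1 => ->; rewrite (on_geod_edge treeP) // negbK.
have IHz z' u : e z z' -> z' != x -> 0 < a u -> on_geod e z u z' -> filled z z'.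
  move=> ez' z'x au gu; apply: (IH z z' u) => //; last first.
    by apply: contra gs => h; exact: (branch_sub spl ez ez' z'x h).
  (* The smaller branch is properly contained in the larger one, since it misses [z]. *)
  apply: (@leq_trans #|[set y | on_geod e x y z]|); last by rewrite -ltnS.
  apply: proper_card; apply/properP; split.
    apply/fintype.subsetP => y; rewrite !finset.in_set => h.
    exact: (branch_sub spl ez ez' z'x h).
  by exists z; rewrite !finset.in_set ?on_geod_r // on_geodxx // edge_neq.
have exc1 := filled_excess nz ez1 (IHz z1 t ez1 z1x at0 gt1).
have excx : excess z x.
  by apply: support_excess as0 _ _ => //; rewrite (on_geod_edge treeP).
apply: filled_node => // z' ez' z'x.
have /excess_elim[//|//|u [au gu _]] := excess_all nz ez1 ezx z1x exc1 excx ez'.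
exact: IHz gu.
Qed.

Variable T : {set V}.
Hypothesis T_convex : forall x y w, x \in T -> y \in T -> on_geod e x y w -> w \in T.
Hypothesis supp_T : forall u, 0 < a u -> u \in T.
Hypothesis irredundant : forall x, is_node e x -> x \in T ->
  ~ exists b : V -> R, [/\ forall u, 0 <= b u,
    forall u, b u != 0 -> 0 < a u /\ u != x &
    forall l, W x l = \sum_u b u * W u l].

(** If only leaves were in the support, positivity of [p] would put every leaf there. By convexity
    [T] would contain a node [x], and [W x] is a combination of the basis vectors of the leaves,
    against irredundancy. *)
Lemma support_has_node : (forall l, 0 < p l) -> exists2 s, is_node e s & 0 < a s.
Proof.
move=> p0; apply: contrapT => hn.
have al u : 0 < a u -> is_leaf e u.
  by move=> au; apply: contrapT => /negP nu; apply: hn; exists u.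
have pE l : p l = a (val l).
  rewrite /p (bigD1 (val l)) //= big1 => [|u ul].
    by rewrite addr0 /wvec (valP l) eqxx mulr1.
  have [/al lu|au] := ltrP 0 (a u); last first.
    by have -> : a u = 0; [apply/eqP; rewrite eq_le au a_ge0|rewrite mul0r].
  by rewrite /wvec lu eq_sym (negbTE ul) mulr0.
have aT (l : L) : val l \in T by apply: supp_T; rewrite -pE.
have [_ [x hx] _] := spl.
have nx : is_node e x by rewrite /is_node; move: hx; case: (valency e x) => [|[]].
have [z1 ez1 _] := other_neighbor x nx; have [z2 ez2 z21] := other_neighbor z1 nx.
have [l1 /(alpha_branch nx ez1) g1] := alpha_exists nx ez1.
have [l2 /(alpha_branch nx ez2) g2] := alpha_exists nx ez2.
have xT : x \in T.
  apply: T_convex (aT l1) (aT l2) _.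
  exact: branch_apart spl _ _ _ _ ez1 g1 (branch_disjoint spl ez2 ez1 z21 g2).
apply: (irredundant nx xT).
exists (fun u => if is_leaf e u then (ell e d x u)%:R else 0); split.
- by move=> u; case: ifP.
- move=> u; case: ifPn => [lu _|_]; last by rewrite eqxx.
  have [l E] := leafP lu; subst u; rewrite -pE; split=> //.
  by apply: contraNneq nx => <-.
move=> l; rewrite wvec_node // (bigD1 (val l)) //= (valP l) big1 => [|u ul].
  by rewrite addr0 /wvec (valP l) eqxx mulr1.
by case: ifPn => [lu|_]; rewrite ?mul0r // /wvec lu eq_sym (negbTE ul) mulr0.
Qed.

Lemma filled_all_contra x : is_node e x -> x \in T -> (forall z, e x z -> filled x z) -> False.
Proof. by move=> nx xT fx; apply: (irredundant nx xT); exact: filled_all. Qed.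

(** Otherwise the vertex [x] after [s] is an interior node with excess towards both [s] and [t],
    hence on every branch. The branch of [s] is filled by [filled_support], the others by
    [filled_of_support], so [W x] would be redundant. *)
Lemma support_adjacent s t : is_node e s -> 0 < a s -> 0 < a t -> s != t -> e s t.
Proof.
move=> ns as0 at0 st; have [x esx gx] := next_vertex treeP st.
have [<-//|xt] := eqVneq x t.
have nx := interior_is_node spl gx (edge_neq esx) xt.
have exs : e x s by rewrite (tree_sym treeP).
have [y ey gy] := next_vertex treeP xt.
have ys : y != s.
  by apply: contraTneq gy => ->; rewrite (on_geod_edge treeP) // negbK.
have gss := on_geod_r spl x s.
have apart z : e x z -> z != s -> ~~ on_geod e x s z.
  by move=> ez zs; apply: (branch_disjoint spl exs) => //; rewrite eq_sym.
have fill z u : e x z -> z != s -> 0 < a u -> on_geod e x u z -> filled x z.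
  by move=> ez zs; exact: filled_of_support ns as0 nx ez (apart z ez zs).
have excs : excess x s by exact: support_excess gss.
have excy := filled_excess nx ey (fill y t ey ys at0 gy).
case: (filled_all_contra nx (T_convex (supp_T as0) (supp_T at0) gx)) => z ez.
have [->|zs] := eqVneq z s; first exact: filled_support.
have /excess_elim[//|//|u [au gu _]] := excess_all nx ey exs ys excy excs ez.
exact: fill gu.
Qed.

(** Two support neighbours of [s] would force excess on every branch at [s]. Each branch then
    contains a support vertex, adjacent to [s] by [support_adjacent], so all branches are filled and
    [W s] is redundant. *)
Lemma support_edge s t t' : is_node e s -> 0 < a s -> 0 < a t -> 0 < a t' ->
  s != t -> s != t' -> t = t'.
Proof.
move=> ns as0 at0 at0' st st'; apply/eqP; apply: contrapT => /negP tt'.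
have est := support_adjacent ns as0 at0 st.
have est' := support_adjacent ns as0 at0' st'.
have exc := filled_excess ns est (filled_support ns est at0).
have exc' := filled_excess ns est' (filled_support ns est' at0').
case: (filled_all_contra ns (supp_T as0)) => z ez.
have /excess_elim[//|//|u [au gu _]] := excess_all ns est est' tt' exc exc' ez.
have su : s != u by apply: contraTneq gu => <-; rewrite on_geodxx // edge_neq.
have esu := support_adjacent ns as0 au su.
have <- : u = z by apply: (next_vertex_unique treeP esu ez _ gu); rewrite on_geod_r.
exact: filled_support.
Qed.

End Support.
End Decomposition.
End Weights.

(** * Monomials in the initial ideal *)

Section ConstantSeries.
Variables (L : finType) (C : numDomainType).

Definition const_ser (b : C) : pser L C := fun m => if m == [ffun=> 0%N] then b else 0.

Lemma const_ser_convergent b : convergent (const_ser b).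
Proof.
exists 1, `|b|; split=> // m; rewrite expr1n mulr1 /const_ser.
by case: ifP; rewrite ?normr0.
Qed.

Lemma pmul_const b (f : pser L C) m : pmul (const_ser b) f m = b * f m.
Proof.
rewrite /pmul.
pose x0 : {dffun forall l : L, 'I_(m l).+1} := [ffun l => ord0].
have h0 : [ffun l => val (x0 l)] = [ffun=> 0%N] :> mexp L.
  by apply/ffunP => l; rewrite !ffunE.
rewrite (bigD1 x0) //= big1 => [|x xn]; last first.
  rewrite /const_ser ifN ?mul0r //; apply: contra xn => /eqP/ffunP h.
  by apply/eqP/ffunP => l; apply: val_inj; have := h l; rewrite !ffunE.
rewrite addr0 h0 /const_ser eqxx; congr (_ * f _).
by apply/ffunP => l; rewrite !ffunE subn0.
Qed.

Lemma ideal_gen_comb (S : set (pser L C)) n (b : 'I_n -> C) (f : 'I_n -> pser L C) :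
  (forall k, S (f k)) -> ideal_gen S (fun m => \sum_k b k * f k m).
Proof.
move=> Sf; exists n, (fun k => const_ser (b k)), f; split=> // [k|m].
  exact: const_ser_convergent.
by apply: eq_bigr => k _; rewrite pmul_const.
Qed.

Lemma ideal_gen_self (S : set (pser L C)) f : S f -> ideal_gen S f.
Proof.
move=> Sf; exists 1%N, (fun=> const_ser 1), (fun=> f); split=> // [k|m].
  exact: const_ser_convergent.
by rewrite big_ord1 pmul_const mul1r.
Qed.
End ConstantSeries.

(** * Initial forms of linear combinations of the system *)

Section InitialForms.
Variables (V : finType) (e : rel V) (d : V -> V -> nat) (R : realType).
Variables (alpha : V -> V -> leafT e -> nat) (c : V -> V -> nat -> R[i]).
Variable g : V -> nat -> pser (leafT e) R[i].
Hypothesis diag : splice_diagram e d.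
Hypothesis d_det : edge_determinant e d.
Hypothesis sys : @splice_type_system V e d R alpha c g.

Local Notation L := (leafT e).
Local Notation W := (@wvec V e d R).
Let spl : is_splice_tree e := proj1 diag.

Lemma sys_admissible v x : is_node e v -> e v x -> @admissible V e d v x (alpha v x).
Proof. by case: sys => h _ _ _; exact: h. Qed.

Variables (a : V -> R) (s : V).
Hypothesis a_ge0 : forall u, 0 <= a u.
Hypotheses (s_node : is_node e s) (as_gt0 : 0 < a s).
Let p : L -> R := fun l => \sum_u a u * W u l.

(** Nodes of the support contribute strictly more than to [min_weight], leaves at least 0; the node
    [s] makes the total strict. *)
Lemma higher_terms_weight v i m : is_node e v -> (i < valency e v - 2)%N ->
  g v i m != 0 -> min_weight e d a v < wdot p m.
Proof.
move=> nv iv gm; have [_ _ _ /(_ v i nv iv m gm)[gv gu]] := sys.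
have lt u : is_node e u -> lcoef e d R u v < wdot (W u) m.
  move=> nu; rewrite wdot_node // /lcoef ifN // ltr_nat.
  by have [->|/(gu u nu)//] := eqVneq u v; rewrite (ell_diag spl).
rewrite wdot_sum /min_weight (bigD1 s) //= [X in _ < X](bigD1 s) //=.
rewrite ltr_leD ?ltr_pM2l ?lt // ler_sum // => u _; apply: ler_wpM2l => //.
have [lu|nu] := boolP (is_leaf e u); last exact/ltW/lt.
by have [l E] := leafP lu; subst u; rewrite wdot_leaf /lcoef lu ler0n.
Qed.

Lemma select_neighbors v (Z : {set V}) :
  {subset Z <= [set x | e v x]} -> (#|Z| <= valency e v - 2)%N ->
  exists sigma : 'I_(valency e v - 2) -> V,
    [/\ injective sigma, forall j, e v (sigma j) &
        forall z, z \in Z -> exists j, sigma j = z].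
Proof.
move=> ZN Zle; set N := [set x | e v x].
have szN : size (enum Z ++ enum (N :\: Z)) = valency e v.
  rewrite size_cat -!cardE -[RHS]/#|N| -(cardsID Z N); congr (_ + _)%N.
  apply: eq_card => x; rewrite !inE.
  by case: (boolP (x \in Z)) => [/ZN|]; rewrite ?inE ?andbT ?andbF.
have uN : uniq (enum Z ++ enum (N :\: Z)).
  rewrite cat_uniq !enum_uniq andbT /=; apply/hasPn => x.
  by rewrite mem_enum inE => /andP[xZ _]; rewrite mem_enum.
have lt (j : 'I_(valency e v - 2)) : (j < size (enum Z ++ enum (N :\: Z)))%N.
  by rewrite szN (leq_trans (ltn_ord j)) // leq_subr.
exists (fun j => nth v (enum Z ++ enum (N :\: Z)) j); split.
- by move=> j k /eqP; rewrite nth_uniq // => /eqP/val_inj.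
- move=> j; have := mem_nth v (lt j); rewrite mem_cat !mem_enum => /orP[/ZN|]; first by rewrite inE.
  by rewrite !inE => /andP[].
- move=> z zZ; have zi : (index z (enum Z) < valency e v - 2)%N.
    by apply: leq_trans Zle; rewrite cardE index_mem mem_enum.
  exists (Ordinal zi) => /=.
  by rewrite nth_cat index_mem mem_enum zZ nth_index // mem_enum.
Qed.

(** The edges without excess fit into the rows of one maximal minor. Its inverse yields a
    combination in which, among these edges, only that of [z] survives; all other terms have larger
    weight. *)
Lemma monomial_in_initial_ideal v z :
  is_node e v -> e v z -> ~~ excess d alpha a v z ->
  (#|[set x | e v x & ~~ excess d alpha a v x]| <= valency e v - 2)%N ->
  exists m, @in_ideal L R[i] R p (@system_ideal V e R alpha c g) (monom _ m).
Proof.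
move=> nv ez xz; set Z := [set x | _ & _] => leZ.
have ZP x : x \in Z = e v x && ~~ excess d alpha a v x by rewrite finset.in_set.
have [||sigma [sI sN sZ]] := @select_neighbors v Z.
- by move=> x; rewrite ZP finset.in_set => /andP[].
- exact: leZ.
have [j0 j0z] := sZ z (etrans (ZP z) (introT andP (conj ez xz))).
have [_ /(_ v nv sigma sI sN) detM _ _] := sys.
set M := \matrix_(_, _) _ in detM.
have Mu : M \in unitmx by rewrite unitmxE unitfE.
(* The solution of [M *m beta] equal to the unit vector at [j0], the row of [z]. *)
pose beta := invmx M *m (delta_mx j0 0 : 'cV_(valency e v - 2)).
have betaE j : \sum_i beta i 0 * c v (sigma j) (val i) = (j == j0)%:R.
  have : (M *m beta) j 0 = (j == j0)%:R by rewrite mulKVmx // mxE eqxx andbT.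
  by rewrite mxE => <-; apply: eq_bigr => i _; rewrite mulrC /M [in RHS]mxE.
pose f : pser L R[i] := fun m => \sum_i beta i 0 * Fsys alpha c g v (val i) m.
have fE m : f m = \sum_(x | e v x)
      (if m == mvx alpha v x then \sum_i beta i 0 * c v x (val i) else 0)
    + \sum_i beta i 0 * g v (val i) m.
  rewrite /f /Fsys; under eq_bigr do rewrite mulrDr; rewrite big_split; congr (_ + _).
  under eq_bigr do rewrite big_distrr /=.
  rewrite exchange_big; apply: eq_bigr => x _ /=; case: ifP => // _.
  by rewrite big1 // => i _; rewrite mulr0.
have coefE x : e v x -> ~~ excess d alpha a v x ->
    \sum_i beta i 0 * c v x (val i) = (x == z)%:R.
  move=> ex xx; have [|j <-] := sZ x; first by rewrite ZP ex.
  by rewrite betaE -j0z (inj_eq sI).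
have wz : wdot p (mvx alpha v z) = min_weight e d a v.
  apply/eqP; rewrite eq_le (min_weight_le diag d_det sys_admissible a_ge0 nv ez) andbT.
  by rewrite leNgt.
have gE m : ~~ (min_weight e d a v < wdot p m) -> \sum_i beta i 0 * g v (val i) m = 0.
  move=> hm; rewrite big1 // => i _.
  have [->|gm] := eqVneq (g v (val i) m) 0; first by rewrite mulr0.
  by case/negP: hm; exact: higher_terms_weight nv (ltn_ord i) gm.
have fz : f (mvx alpha v z) = 1.
  rewrite fE gE ?wz ?ltxx // addr0 (bigD1 z) //= eqxx coefE // eqxx big1 ?addr0 //.
  (* Another edge with the same monomial has no excess either, so its coefficient is 0. *)
  move=> x /andP[ex xz']; case: eqP => // E; rewrite coefE ?(negbTE xz') //.
  by rewrite /excess -E wz ltxx.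
have fm m : f m != 0 -> m != mvx alpha v z -> wdot p (mvx alpha v z) < wdot p m.
  move=> fm mz; rewrite wz; apply: contraNT fm => hm.
  rewrite fE gE // addr0 big1 // => x ex; case: eqP => // E.
  have xz' : x != z by apply: contraNneq mz => <-; rewrite E.
  by rewrite coefE ?(negbTE xz') // /excess -E.
exists (mvx alpha v z); suff -> : monom R[i] (mvx alpha v z) = in_w p f.
  apply: ideal_gen_self; exists f => //.
  apply: (ideal_gen_comb (fun i => beta i 0) (f := fun i => Fsys alpha c g v (val i))) => k.
  by exists v, (val k); split=> //; exact: ltn_ord.
apply/funext => m; rewrite /monom /in_w; have [->|mz] := eqVneq m (mvx alpha v z).
  case: asboolP => [|[]]; first by rewrite fz.
  move=> m' fm'; have [->//|m'z] := eqVneq m' (mvx alpha v z).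
  exact: ltW (fm m' fm' m'z).
case: asboolP => // h; apply/eqP; rewrite eq_sym; apply: contraT => fm'.
have := h (mvx alpha v z); rewrite fz oner_neq0 leNgt => /(_ isT).
by rewrite fm.
Qed.

Lemma excess_all_of_trop v z1 z2 z :
  @tropP L R[i] R (@system_ideal V e R alpha c g) p ->
  is_node e v -> e v z1 -> e v z2 -> z1 != z2 ->
  excess d alpha a v z1 -> excess d alpha a v z2 -> e v z -> excess d alpha a v z.
Proof.
move=> [_ trop] nv e1 e2 z12 x1 x2 ez; apply: contrapT => /negP xz; apply: trop.
apply: (monomial_in_initial_ideal nv ez xz).
have -> : (valency e v - 2 = #|[set u | e v u] :\ z1 :\ z2|)%N.
  rewrite /valency [in LHS](cardsD1 z1) [in LHS](cardsD1 z2) !finset.inE e1 e2.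
  by rewrite eq_sym z12 addnA addnC addnK.
apply: subset_leq_card; apply/fintype.subsetP => x; rewrite !finset.inE => /andP[-> xx].
by rewrite !andbT; apply/andP; split; apply: contraNneq xx => ->.
Qed.
End InitialForms.

(** * Decompositions of minimal potential *)

Section Minimisation.
Import topology normedtype derive numFieldNormedType.Exports.
Local Open Scope classical_set_scope.
Variable R : realType.

Lemma continuous_functional n (k : 'I_n -> R) :
  continuous (fun a : 'rV[R]_n => \sum_j a ord0 j * k j).
Proof.
apply: continuous_big => [|j _]; first exact: add_continuous.
move=> a; apply: (cvgMr_tmp (f := fun a : 'rV[R]_n => a ord0 j)).
  exact: (nbhs_filter a).
exact: coord_continuous.
Qed.

(** The bounds [B] make the feasible set a closed part of a box, hence compact, and a linear
    functional attains its minimum there. [J] is enumerated in order to work with row vectors. *)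
Lemma min_combination (J L : finType) (w : J -> L -> R) (p : L -> R)
    (h B a0 : J -> R) :
  (forall j, 0 <= a0 j <= B j) -> (forall l, \sum_j a0 j * w j l = p l) ->
  exists a : J -> R, [/\ forall j, 0 <= a j <= B j,
    forall l, \sum_j a j * w j l = p l &
    forall b : J -> R, (forall j, 0 <= b j <= B j) ->
      (forall l, \sum_j b j * w j l = p l) ->
      \sum_j a j * h j <= \sum_j b j * h j].
Proof.
move=> a0B a0p; pose n := #|J|.
have sumE (f : J -> R) (x : 'rV[R]_n) (b : J -> R) :
    (forall j, x ord0 (enum_rank j) = b j) ->
    \sum_i x ord0 i * f (enum_val i) = \sum_j b j * f j.
  move=> xb; rewrite (reindex enum_rank) /=; last first.
    by exists enum_val => i _; rewrite ?enum_rankK ?enum_valK.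
  by apply: eq_bigr => j _; rewrite xb enum_rankK.
pose box := [set x : 'rV[R]_n | forall i, `[0, B (enum_val i)] (x ord0 i)].
pose eqs := \bigcap_(l in [set: L])
  [set x : 'rV[R]_n | \sum_i x ord0 i * w (enum_val i) l = p l].
have cA : compact (eqs `&` box).
  rewrite setIC; apply: compact_closedI.
    apply: (@rV_compact _ _ (fun i => `[0, B (enum_val i)])) => i.
    exact: segment_compact.
  apply: closed_bigI => l _.
  apply: (@preimage_closed _ _ (fun x : 'rV[R]_n => \sum_i x ord0 i * w (enum_val i) l)
    [set y | y = p l]); last exact: closed_eq.
  by move=> x _; exact: continuous_functional.
pose toV (b : J -> R) : 'rV[R]_n := \row_i b (enum_val i).
have toVE b j : toV b ord0 (enum_rank j) = b j by rewrite mxE enum_rankK.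
have toVA b : (forall j, 0 <= b j <= B j) -> (forall l, \sum_j b j * w j l = p l) ->
    (eqs `&` box) (toV b).
  move=> bB bp; split=> [l _|i] /=.
    by rewrite (sumE (fun j => w j l) (toV b) b) //.
  by rewrite in_itv /= mxE.
have [||x xA xmin] := @compact_EVT_min _ R
    (fun x : 'rV[R]_n => \sum_i x ord0 i * h (enum_val i)) _ _ cA.
- by exists (toV a0); exact: toVA.
- by apply: continuous_subspaceT => y; exact: continuous_functional.
have xE : forall j, x ord0 (enum_rank j) = (fun j => x ord0 (enum_rank j)) j by [].
rewrite inE in xA; have [xeq xbox] := xA.
exists (fun j => x ord0 (enum_rank j)); split.
- by move=> j; have /= := xbox (enum_rank j); rewrite in_itv /= enum_rankK.
- by move=> l; rewrite -(sumE (fun j => w j l) x _ xE); exact: xeq.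
move=> b bB bp; rewrite -(sumE h x _ xE) -(sumE h (toV b) b) //.
by apply: xmin; rewrite inE; exact: toVA.
Qed.
End Minimisation.

(** A path inside [T] can be made simple, and is then the geodesic by uniqueness. *)
Lemma subtree_convex (V : finType) (e : rel V) (T : {set V}) :
  is_tree e -> subtree e T ->
  forall x y w, x \in T -> y \in T -> on_geod e x y w -> w \in T.
Proof.
move=> tr [_ cT] x y w xT yT; have /connectP[p] := cT x y xT yT.
case/shortenP => q pq uq _ yE; rewrite (on_geod_mem tr) yE.
rewrite (gpath_unique tr) //; last by apply: sub_path pq => s t /and3P[].
rewrite inE => /orP[/eqP->//|wq].
elim: q x {xT cT p uq yE} pq wq => //= z q IH x /andP[/and3P[_ _ zT] pq].
by rewrite inE => /orP[/eqP->//|]; exact: IH pq.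
Qed.

Section Potential.
Variables (V : finType) (e : rel V) (d : V -> V -> nat) (R : realType).
Hypothesis diag : splice_diagram e d.
Hypothesis d_det : edge_determinant e d.
Variable alpha : V -> V -> leafT e -> nat.
Hypothesis alphaP : forall v x, is_node e v -> e v x -> @admissible V e d v x (alpha v x).

Local Notation L := (leafT e).
Local Notation W := (@wvec V e d R).
Local Notation rh := (@rho V e d R).
Let spl : is_splice_tree e := proj1 diag.
Let d_gt0 : positive_weights e d := proj2 diag.
Let treeP := splice_is_tree spl.

Lemma wvec_ge0 u l : 0 <= W u l.
Proof. by rewrite /wvec; case: ifP; rewrite ler0n. Qed.

Lemma norm1_wvec u : norm1 (W u) = \sum_l W u l.
Proof. by apply: eq_bigr => l _; rewrite ger0_norm ?wvec_ge0. Qed.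

Lemma norm1_wvec_gt0 u : 0 < norm1 (W u).
Proof.
rewrite norm1_wvec; suff [l Wl] : exists l, 0 < W u l.
  by rewrite (bigD1 l) //= ltr_pwDl // sumr_ge0 // => l' _; exact: wvec_ge0.
have [lu|nu] := boolP (is_leaf e u).
  by have [l E] := leafP lu; exists l; rewrite /wvec lu E eqxx ltr01.
have [z ez _] := other_neighbor diag u nu; have [l _] := alpha_exists diag alphaP nu ez.
by exists l; rewrite wvec_node // ltr0n (ell_gt0 d_gt0).
Qed.

Lemma norm1_rho u l : norm1 (W u) * rh u l = W u l.
Proof. by rewrite mulrC divfK // gt_eqF // norm1_wvec_gt0. Qed.

Lemma sum_rho u : \sum_l rh u l = 1.
Proof. by rewrite -mulr_suml -norm1_wvec divff // gt_eqF // norm1_wvec_gt0. Qed.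

(** Equality would make [W u] a positive multiple of [W v], hence of equal weight on all monomials
    at [v]. But a node [u] weighs more on its own branch than elsewhere, and a leaf [u] has weight 0
    on other branches. *)
Lemma rho_neq v u : is_node e v -> v != u -> exists l, rh u l != rh v l.
Proof.
move=> nv vu; apply: contrapT => hn.
have E l : rh u l = rh v l by apply: contrapT => /eqP h; apply: hn; exists l.
have [z ez gz] := next_vertex treeP vu.
have [z' ez' zz'] := other_neighbor diag z nv.
pose k := norm1 (W u) / norm1 (W v).
have k0 : 0 < k by rewrite divr_gt0 ?norm1_wvec_gt0.
have Wk m : wdot (W u) m = k * wdot (W v) m.
  rewrite -wdotZ; apply: eq_bigr => l _; congr (_ * _).
  rewrite -(norm1_rho u) -(norm1_rho v) E mulrA /k divfK //.
  by rewrite gt_eqF // norm1_wvec_gt0.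
have vv y : e v y -> ~~ on_geod e v v y.
  by move=> ey; rewrite (on_geodxx spl) (edge_neq diag ey).
have E1 := Wk (mvx alpha v z); have E2 := Wk (mvx alpha v z').
rewrite !(wdot_apart R diag alphaP nv _ (vv _ _)) // in E1 E2.
rewrite (wdot_apart R diag alphaP nv ez' (branch_disjoint spl ez ez' _ gz)) 1?eq_sym // in E2.
have [lu|nu] := boolP (is_leaf e u); last first.
  by have := wdot_branch R diag d_det alphaP nv ez nu gz; rewrite E1 -E2 ltxx.
by have := mulr_gt0 k0 (lcoef_diag R diag nv); rewrite -E2 /lcoef lu ltxx.
Qed.

(** The value at [W u] of the convex function sending [w] to its squared 2-norm divided by its
    1-norm, homogeneous of degree one. *)
Definition potential u : R := \sum_l W u l * rh u l.

(* [potential u] minus the linear functional [2 <w_u, rho v> - |w_u| |rho v|^2]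
   is [|w_u| |rho u - rho v|^2], which vanishes at [u = v]. *)
Lemma potential_lt v (b : V -> R) : is_node e v -> (forall u, 0 <= b u) ->
  (forall u, b u != 0 -> u != v) -> (forall l, W v l = \sum_u b u * W u l) ->
  potential v < \sum_u b u * potential u.
Proof.
move=> nv b0 bv E; pose s := \sum_l rh v l * rh v l.
pose B (w : L -> R) := \sum_l (2 * rh v l - s) * w l.
have BE u : potential u - B (W u) = norm1 (W u) * \sum_l (rh u l - rh v l) ^+ 2.
  apply/eqP; rewrite subr_eq; apply/eqP.
  have <- : \sum_l 2 * (W u l * rh v l) - norm1 (W u) * s = B (W u).
    apply/eqP; rewrite subr_eq norm1_wvec mulr_suml -big_split /=.
    by apply/eqP/eq_bigr => l _; ring.
  apply/eqP; rewrite addrA eq_sym subr_eq eq_sym; apply/eqP.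
  rewrite /s !mulr_sumr -!big_split; apply: eq_bigr => l _ /=.
  by rewrite -(norm1_rho u l); ring.
have Bv : B (W v) = \sum_u b u * B (W u).
  rewrite /B; under eq_bigr do rewrite E mulr_sumr.
  rewrite exchange_big; apply: eq_bigr => u _; rewrite mulr_sumr.
  by apply: eq_bigr => l _; rewrite mulrCA.
have -> : potential v = B (W v).
  apply/eqP; rewrite -subr_eq0 BE big1 ?mulr0 // => l _.
  by rewrite subrr expr0n.
rewrite Bv -subr_gt0 -sumrN -big_split /=.
have F u : b u * potential u - b u * B (W u) = b u * (norm1 (W u) * \sum_l (rh u l - rh v l) ^+ 2).
  by rewrite -mulrBr BE.
under eq_bigr do rewrite F.
have F0 u : 0 <= b u * (norm1 (W u) * \sum_l (rh u l - rh v l) ^+ 2).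
  by rewrite mulr_ge0 // mulr_ge0 ?(ltW (norm1_wvec_gt0 _)) // sumr_ge0 // => l _; exact: sqr_ge0.
have [u bu] : exists u, b u != 0.
  apply: contrapT => hn; have := norm1_wvec_gt0 v.
  rewrite norm1_wvec big1 ?ltxx // => l _; rewrite E big1 // => u _.
  have [->|bu] := eqVneq (b u) 0; first by rewrite mul0r.
  by case: hn; exists u.
rewrite (bigD1 u) //= ltr_pwDl ?sumr_ge0 //.
rewrite lt_neqAle eq_sym F0 andbT !mulf_neq0 // ?gt_eqF ?norm1_wvec_gt0 //.
have [l hl] := rho_neq nv (negbT (etrans (eq_sym _ _) (negbTE (bv u bu)))).
rewrite (bigD1 l) //= ltr_pwDl ?sumr_ge0 // => [|l' _]; last exact: sqr_ge0.
by rewrite lt_neqAle sqr_ge0 eq_sym sqrf_eq0 subr_eq0 hl.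
Qed.

Lemma positive_step (a b : V -> R) : (forall u, 0 <= a u) -> (forall u, 0 <= b u) ->
  (forall u, b u != 0 -> 0 < a u) -> exists2 t, 0 < t & forall u, t * b u <= a u.
Proof.
(* Terms with [a u = 0] vanish, because then [b u = 0]. *)
move=> a0 b0 ab; pose S := 1 + \sum_u b u / a u.
have S0 : 0 < S by rewrite ltr_pwDl // sumr_ge0 // => u _; rewrite divr_ge0.
exists S^-1 => [|u]; first by rewrite invr_gt0.
rewrite mulrC ler_pdivrMr //.
have [->|/ab au] := eqVneq (b u) 0; first by rewrite mulr_ge0 // ltW.
rewrite -ler_pdivrMl // mulrC /S (bigD1 u) //= addrCA lerDl addr_ge0 //.
by rewrite sumr_ge0 // => u' _; rewrite divr_ge0.
Qed.

(* Trading a combination for [w_v] would lower the potential of a minimiser. *)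
Lemma irredundant_decomposition (T : {set V}) (p : L -> R) : DeltaT d T p ->
  exists a : V -> R, [/\ forall u, 0 <= a u, forall u, 0 < a u -> u \in T,
    forall l, p l = \sum_u a u * W u l &
    forall v, is_node e v -> v \in T ->
      ~ exists b : V -> R, [/\ forall u, 0 <= b u,
          forall u, b u != 0 -> 0 < a u /\ u != v &
          forall l, W v l = \sum_u b u * W u l]].
Proof.
move=> [c [c0 cT c1 pE]].
have n0 u := norm1_wvec_gt0 u.
(* Inside [T] the bound is automatic, as [p] has 1-norm 1; the bound 0 outside [T] keeps the support
   in [T]. *)
pose B u : R := if u \in T then (norm1 (W u))^-1 else 0.
have p1 : \sum_l p l = 1.
  rewrite pE exchange_big -c1; apply: eq_bigr => u _.
  by rewrite -mulr_sumr sum_rho mulr1.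
have feasible a : (forall u, 0 <= a u) -> (forall u, u \notin T -> a u = 0) ->
    (forall l, \sum_u a u * W u l = p l) -> forall u, 0 <= a u <= B u.
  move=> a0 aT ap u; rewrite a0 /B; case: ifPn => [_|/aT->]; rewrite ?lexx //=.
  rewrite -[X in _ <= X]mul1r ler_pdivlMr // -p1 norm1_wvec mulr_sumr.
  apply: ler_sum => l _; rewrite -ap (bigD1 u) //= lerDl sumr_ge0 // => v _.
  by rewrite mulr_ge0 ?wvec_ge0.
have cE l : \sum_u c u / norm1 (W u) * W u l = p l.
  by rewrite pE; apply: eq_bigr => u _; rewrite mulrAC mulrA.
have cB : forall u, 0 <= c u / norm1 (W u) <= B u.
  apply: feasible => [u|u uT|//]; first by rewrite divr_ge0 // ltW.
  by rewrite cT ?mul0r // /leaf_of (negbTE uT).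
have [a [aB ap amin]] := min_combination potential cB cE.
have a0 u : 0 <= a u by case/andP: (aB u).
have aT u : u \notin T -> a u = 0.
  by move=> uT; apply/eqP; rewrite eq_le; have := aB u; rewrite /B (negbTE uT) andbC.
have aT' u : 0 < a u -> u \in T.
  by apply: contraTT => /aT->; rewrite ltxx.
exists a; split=> // v nv vT [b [b0 bP bE]].
have [|t t0 tP] := positive_step a0 b0; first by move=> u /bP[].
(* Replacing [t] times the combination by [t] times [W v] leaves [p] unchanged and, for small [t],
   the coefficients nonnegative. *)
pose a' u := a u - t * b u + (if u == v then t else 0).
have a'sum f : \sum_u a' u * f u = \sum_u a u * f u - t * \sum_u b u * f u + t * f v.
  rewrite mulr_sumr -sumrN -big_split (bigD1 v) //= [in RHS](bigD1 v) //= /a' eqxx.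
  rewrite [X in _ + X = _](eq_bigr (fun u => a u * f u - t * (b u * f u))).
    by ring.
  by move=> u /negbTE->; ring.
have := amin a' _ _; rewrite a'sum => lt.
have := potential_lt nv b0 (fun u h => (bP u h).2) bE.
rewrite -(ltr_pM2l t0) => lt'.
suff : \sum_j a j * potential j <=
    \sum_j a j * potential j - t * (\sum_j b j * potential j) + t * potential v by lra.
have a'E l : \sum_u a' u * W u l = p l by rewrite a'sum -bE subrK.
apply: lt => //; apply: feasible => [u|u uT|//]; rewrite /a'.
  by rewrite addr_ge0 ?subr_ge0 //; case: ifP => // _; exact: ltW.
have [uv|_] := eqVneq u v; first by rewrite uv vT in uT.
have [->|/bP[/aT']] := eqVneq (b u) 0; first by rewrite aT // mulr0 subrr addr0.
by rewrite (negbTE uT).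
Qed.
End Potential.

Theorem theorem6p5 (V : finType) (e : rel V) (d : V -> V -> nat)
    (R : realType)
    (alpha : V -> V -> leafT e -> nat) (c : V -> V -> nat -> R[i])
    (g : V -> nat -> pser (leafT e) R[i]) :
  splice_diagram e d ->
  edge_determinant e d ->
  semigroup_condition e d ->
  @splice_type_system V e d R alpha c g ->
  forall T : {set V}, subtree e T -> star_full e T ->
    forall p : leafT e -> R,
      @DeltaT V e d R T p ->
      @tropP (leafT e) R[i] R (@system_ideal V e R alpha c g) p ->
      @rhoT V e d R T p.
Proof.
move=> diag d_det _ sys T subT _ p pT trop.
have alphaP := sys_admissible sys.
have n0 u := norm1_wvec_gt0 R diag alphaP u.
have p1 : \sum_l p l = 1.
  case: pT => c' [_ _ c1 ->]; rewrite exchange_big -c1; apply: eq_bigr => u _.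
  by rewrite -mulr_sumr (sum_rho R diag alphaP) mulr1.
have [a [a0 aT pE irr]] := irredundant_decomposition diag d_det alphaP pT.
have {pE} pE : p = (fun l => \sum_u a u * @wvec V e d R u l) by apply/funext.
have T_convex := subtree_convex (splice_is_tree (proj1 diag)) subT.
have p0 (l : leafT e) : 0 < \sum_u a u * @wvec V e d R u l.
  by have [h _] := trop; have := h l; rewrite pE.
have [s ns as0] := support_has_node diag alphaP a0 T_convex aT irr p0.
have exc x z1 z2 z : is_node e x -> e x z1 -> e x z2 -> z1 != z2 ->
    excess d alpha a x z1 -> excess d alpha a x z2 -> e x z -> excess d alpha a x z.
  by apply: (excess_all_of_trop diag d_det sys a0 ns as0); rewrite -pE.
have aE u : ~ 0 < a u -> a u = 0.
  by move=> /negP; rewrite -leNgt => h; apply/eqP; rewrite eq_le h a0.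
(* Either the support has a second vertex, and [p] lies on the image of an edge, or it is [s] alone,
   and [p] is [rho s]. *)
have [[t at0 st]|h1] := pselect (exists2 t, 0 < a t & s != t).
  have only u : u != s -> u != t -> a u = 0.
    move=> us ut; apply: aE => au; case/negP: ut.
    rewrite eq_sym in us; rewrite eq_sym; apply/eqP.
    exact: (support_edge diag d_det alphaP a0 exc T_convex aT irr ns as0 at0 au st us).
  have pst (l : leafT e) : p l = a s * @wvec V e d R s l + a t * @wvec V e d R t l.
    rewrite pE (bigD1 s) //= (bigD1 t) 1?eq_sym //= big1 ?addr0 // => u /andP[us ut].
    by rewrite only ?mul0r.
  have sum1 : a s * norm1 (@wvec V e d R s) + a t * norm1 (@wvec V e d R t) = 1.
    rewrite -p1 !norm1_wvec !mulr_sumr -big_split.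
    by apply: eq_bigr => l _; rewrite pst.
  have h k u : 0 <= k -> 0 <= k * norm1 (@wvec V e d R u) by move=> k0; rewrite mulr_ge0 // ltW.
  (* The parameter is the share of [W t] in the 1-norm of [p], which is 1. *)
  right; exists s, t, (a t * norm1 (@wvec V e d R t)); split.
  - rewrite /Defs.subrel /= !aT // !andbT.
    exact: (support_adjacent diag d_det alphaP a0 exc T_convex aT irr ns as0 at0 st).
  - exact: h.
  - by rewrite -sum1 lerDr h.
  - apply/funext => l; rewrite pst -(norm1_rho R diag alphaP s) -(norm1_rho R diag alphaP t) !mulrA.
    by congr (_ * _ + _); rewrite -sum1 addrK.
have ps (l : leafT e) : p l = a s * @wvec V e d R s l.
  rewrite pE (bigD1 s) //= big1 ?addr0 // => u us.
  by rewrite aE ?mul0r // => au; apply: h1; exists u; rewrite // eq_sym.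
left; exists s; first exact: aT.
have sum1 : a s * norm1 (@wvec V e d R s) = 1.
  by rewrite -p1 norm1_wvec mulr_sumr; apply: eq_bigr => l _; rewrite ps.
by apply/funext => l; rewrite ps -(norm1_rho R diag alphaP s) mulrA sum1 mul1r.
Qed.
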